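(* Let $\mathcal H$ be a nonseparable complex Hilbert space. For each infinite cardinal $\alpha\le\dim\mathcal H$ let $J_\alpha$ be the set of all operators $A\in\mathcal B(\mathcal H)$ such that either $\iota_r(A)<\alpha$, or $\iota_r(A)=\alpha$ and $\iota_b(A)=0$. Then for each infinite $\alpha\le\dim\mathcal H$, $J_\alpha$ is a closed two-sided ideal in $\mathcal B(\mathcal H)$; $J_\alpha\ne J_{\alpha'}$ if $\alpha\ne\alpha'$; and every nonzero proper closed two-sided ideal in $\mathcal B(\mathcal H)$ coincides with some $J_\alpha$.
   Context: $\mathcal B(\mathcal H)$ is the algebra of bounded linear operators on $\mathcal H$; closedness is in the operator norm. $\dim$ is the Hilbert space dimension (the cardinality of an orthonormal basis). $\iota_r(A)=\dim\overline{\mathcal R}(A)$, where $\overline{\mathcal R}(A)$ is the closure of the range $\mathcal R(A)$ of $A$. For a pre-Hilbert space $\mathcal E$ with completion $\overline{\mathcal E}$, $\mathfrak b(\mathcal E)=1$ if $\mathcal E$ contains a (necessarily complete) subspace isomorphic to $\overline{\mathcal E}$, and $\mathfrak b(\mathcal E)=0$ otherwise; $\iota_b(A)=\mathfrak b(\mathcal R(A))$. *)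

(* Defs.v *)
From HB Require Import structures.
From mathcomp Require Import all_boot all_order all_algebra.
From mathcomp Require Export complex.
From mathcomp Require Import all_classical all_reals all_analysis.
Set Implicit Arguments.
Unset Strict Implicit.
Unset Printing Implicit Defensive.
Import Order.TTheory GRing.Theory Num.Theory.
Import numFieldNormedType.Exports.
Local Open Scope classical_set_scope.
Local Open Scope ring_scope.
Local Open Scope card_scope.
Local Open Scope complex_scope.

(* As in [mathcomp.classical.cardinality], a cardinal is represented by a set
   of that cardinality, on an arbitrary type: equality of cardinals is [#=],
   their order is [#<=]. *)
Definition card_lt (T U : Type) (A : set T) (B : set U) : bool :=
  (A #<= B) && (A #!= B).

Definition separable (T : topologicalType) : Prop :=
  exists D : set T, countable D /\ dense D.

(* A complex Hilbert space is a complete normed module over R[i] whose norm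
   comes from an inner product [dot], linear in its first argument; norms are
   elements of R[i]. *)
Definition norm_from_dot (R : realType) (H : completeNormedModType R[i])
    (dot : {dot H for Num.conj}) : Prop :=
  forall x : H, `|x| ^+ 2 = dot x x.

Section Hilbert.
Context {R : realType} {H : completeNormedModType R[i]}.
Variable dot : {dot H for Num.conj}.

Definition subspace_of_hilbert (V : set H) : Prop :=
  V 0 /\ forall (c : R[i]) (x y : H), V x -> V y -> V (c *: x + y).

Definition lin_span (B : set H) : set H :=
  \bigcap_(V in [set V | subspace_of_hilbert V /\ B `<=` V]) V.

Definition orthonormal_set (B : set H) : Prop :=
  forall x y : H, B x -> B y -> dot x y = (x == y)%:R.

Definition orthonormal_basis (M B : set H) : Prop :=
  orthonormal_set B /\ closure (lin_span B) = M.

(* The Hilbert space dimension of a closed subspace M, as a cardinal: some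
   orthonormal basis of M, the choice being irrelevant up to [#=]. The default
   value [set0] only matters when M is not a closed subspace. *)
Definition hdim (M : set H) : set H := xget set0 (orthonormal_basis M).

(* Isomorphism of pre-Hilbert spaces; only the restriction of U to E matters,
   and it is injective because it preserves the inner product. *)
Definition prehilbert_isomorphic (E F : set H) : Prop :=
  exists U : H -> H,
    [/\ forall (c : R[i]) (x y : H), E x -> E y -> U (c *: x + y) = c *: U x + U y,
        forall x y : H, E x -> E y -> dot (U x) (U y) = dot x y
      & U @` E = F].

(* H being complete, the completion of a subspace E of H is its closure. *)
Definition frakb (E : set H) : nat :=
  `[< exists F : set H,
        [/\ subspace_of_hilbert F, F `<=` E
          & prehilbert_isomorphic (closure E) F] >].

Definition bounded_op : set (H -> H) :=
  [set A | linear A /\ exists M : R, forall x : H, `|A x| <= M%:C * `|x|].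

Definition opnorm (A : H -> H) : R :=
  sup [set complex.Re `|A x| | x in [set x : H | `|x| <= 1]].

Definition opnorm_closed (J : set (H -> H)) : Prop :=
  forall A : H -> H, bounded_op A ->
    (forall e : R, 0 < e -> exists2 B, J B & opnorm (A - B) < e) -> J A.

Definition two_sided_ideal (J : set (H -> H)) : Prop :=
  [/\ J `<=` bounded_op,
      J 0,
      forall A B : H -> H, J A -> J B -> J (A + B),
      forall (c : R[i]) (A : H -> H), J A -> J (c *: A)
    & forall T A : H -> H, bounded_op T -> J A -> J (T \o A) /\ J (A \o T)].

Definition closed_ideal (J : set (H -> H)) : Prop :=
  two_sided_ideal J /\ opnorm_closed J.

Definition iota_r (A : H -> H) : set H := hdim (closure (range A)).

Definition iota_b (A : H -> H) : nat := frakb (range A).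

Definition Jideal (T : Type) (alpha : set T) : set (H -> H) :=
  [set A | bounded_op A /\
    (card_lt (iota_r A) alpha \/ (iota_r A #= alpha /\ iota_b A = 0%N))].

Definition admissible_card (T : Type) (alpha : set T) : Prop :=
  infinite_set alpha /\ alpha #<= hdim [set: H].

End Hilbert.

(* Main.v *)
Require Import Defs.
From mathcomp Require Import all_boot all_order all_algebra finmap.
From mathcomp Require Import all_classical all_reals all_analysis.
From mathcomp Require Import ring lra.
Set Implicit Arguments.
Unset Strict Implicit.
Unset Printing Implicit Defensive.
Import Order.TTheory GRing.Theory Num.Theory.
Import numFieldNormedType.Exports.
Local Open Scope classical_set_scope.
Local Open Scope ring_scope.
Local Open Scope card_scope.
Local Open Scope complex_scope.

(** The proof replaces the two-case definition of the ideal attached to a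
    cardinal by a single approximation property.  Call a bounded operator [A]
    compact relative to an infinite cardinal [a] ([card_compact]) when for
    every [e > 0] there is a set [D] with fewer than [a] elements such that
    every [A x] is within [e * |x|] of the span of [D].  For countable [a]
    these are the compact operators.  Since two sets of cardinality less than
    [a] have a union of cardinality less than [a], sums, compositions with
    bounded operators and norm limits preserve the property, so these
    operators form a closed ideal ([card_compact_closed_ideal]).

    The main tool is a dichotomy ([bounded_below_set_exists]): a bounded
    operator that is not compact relative to [a] maps some orthonormal set [X]
    with at least [a] elements to an orthogonal set, with [|A x| >= e > 0] on
    [X].  Such an [X] is a maximal set with these properties: were it smaller
    than [a], the images under [A] of the vectors [x] of [X] and of the
    [A^* A x] would not approximate the range, and this provides one more
    vector.  On the closed span of [X] the operator has a bounded inverse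
    ([bounded_below_inverse]), so its range contains a closed subspace of
    dimension [|X|].

    The ideal [Jideal dot a] is exactly this class ([JidealE]).  If [A] is in
    [Jideal dot a] but not in the class, the closed subspace above has
    dimension at least [a], hence exactly [a], and is isomorphic to the
    closure of the range, which contradicts [iota_b A = 0].  Conversely, if
    [A] is in the class, then the countably many sets that approximate it at
    the scales [4^-n] show that its range has dimension at most [a].  When the
    dimension is [a], an isometric copy of the closure inside the range is
    excluded by a gliding hump: a suitable series [z] of basis vectors with
    coefficients [2^-n] would be sent to a vector [A x] whose distance to the
    [n]-th approximating span is at least about [2^-n], although it is at most
    [4^-n * |x|].

    The rest is formal.  An orthogonal projection lies in the class of [a] iff
    its rank is less than [a], so different cardinals give different ideals.
    Given a closed ideal [I], nonzero and proper, let [a] be a smallest subset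
    of an orthonormal basis of [H] whose projection is not in [I].  If [I]
    contained an operator outside the class of [a], the dichotomy would
    factor the projection onto [a] through it; and an operator in the class of
    [a] is a limit of its compositions with projections of smaller rank, which
    all belong to [I]. *)

(** * Comparison of cardinals *)

Lemma set_inj_card_le T U (A : set T) (B : set U) (f : T -> U) :
  (forall x, A x -> B (f x)) ->
  (forall x y, A x -> A y -> f x = f y -> x = y) -> A #<= B.
Proof.
move=> fAB finj; have [g] : $|{injfun A >-> B}|.
  apply/injfunPex; exists f; first by move=> x /fAB.
  by move=> x y /set_mem Ax /set_mem Ay; exact: finj.
exact: inj_card_le g.
Qed.

Lemma card_leE T (U : pointedType) (A : set T) (B : set U) : A #<= B ->
  exists f : T -> U, (forall x, A x -> B (f x)) /\
    (forall x y, A x -> A y -> f x = f y -> x = y).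
Proof.
move=> /pcard_leP/injfunPex[f fAB finj]; exists f; split; first exact: fAB.
by move=> x y Ax Ay; apply: finj; rewrite inE.
Qed.

(** Cardinals are well ordered.  Take a maximal set [Z] of choice functions any
    two of which differ at every index.  If at each index some value were
    missed by [Z], these values would form a function to be added; so [Z]
    covers all of [X i0] for some [i0], and evaluation at another index embeds
    [Z], hence [X i0], into [X i]. *)
Lemma card_min I (T : pointedType) (D : set I) (X : I -> set T) :
  D !=set0 -> exists i0, D i0 /\ forall i, D i -> X i0 #<= X i.
Proof.
move=> [d Dd].
pose P (Z : set (I -> T)) :=
  (forall g i, Z g -> D i -> X i (g i)) /\
  (forall g h i, Z g -> Z h -> D i -> g i = h i -> g = h).
have [F FP Ftot|Z [[Z1 Z2] Zmax]] := @Zorn_bigcup _ P.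
  split=> [g i [Y FY Yg] Di|g h i [Y FY Yg] [Y' FY' Yh] Di gh].
    exact: (FP _ FY).1.
  have [YY'|Y'Y] := Ftot _ _ FY FY'.
    by apply: (FP _ FY').2 gh => //; exact: YY'.
  by apply: (FP _ FY).2 gh => //; exact: Y'Y.
have [i0 [Di0 surj]] : exists i0, D i0 /\
    forall x, X i0 x -> exists g, Z g /\ g i0 = x.
  apply: contrapT => /forallNP nsurj.
  have /choice[g gP] : forall i, exists x, D i ->
      X i x /\ forall h, Z h -> h i != x.
    move=> i; have [Di|nDi] := pselect (D i); last by exists point.
    apply: contrapT => /forallNP h; apply: (nsurj i); split=> // x Xx.
    apply: contrapT => /forallNP nx; apply: (h x) => _; split=> // k Zk.
    by apply/eqP => kx; apply: (nx k).
  have Zg : ~ Z g by move=> Zg; have /eqP := (gP d Dd).2 _ Zg.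
  apply: (Zmax (Z `|` [set g])).
    split; first by left.
    by move=> /(_ g (or_intror erefl)).
  split=> [h i [Zh|->] Di|h k i [Zh|->] [Zk|->] Di //].
  - exact: Z1.
  - exact: (gP i Di).1.
  - exact: Z2.
  - by have /eqP := (gP i Di).2 _ Zh.
  - by move=> /esym; have /eqP := (gP i Di).2 _ Zk.
exists i0; split=> // i Di.
have /choice[h hP] : forall x, exists g, X i0 x -> Z g /\ g i0 = x.
  move=> x; have [/surj[g gP]|nX] := pselect (X i0 x); last by exists (fun=> point).
  by exists g.
apply: (@set_inj_card_le _ _ _ _ (fun x => h x i)) => [x Xx|x y Xx Xy hxy].
  by apply: Z1 => //; case: (hP x Xx).
have [Zx <-] := hP x Xx; have [Zy <-] := hP y Xy.
by rewrite (Z2 _ _ i Zx Zy Di hxy).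
Qed.

Lemma card_le_total (T : pointedType) (A B : set T) : (A #<= B) \/ (B #<= A).
Proof.
have [|[] [_ h]] := @card_min bool T setT (fun b => if b then A else B).
- by exists true.
- by left; exact: (h false).
- by right; exact: (h true).
Qed.

(** Except for finitely many points, [A] is a disjoint union of injective
    sequences: take a maximal family [G] of such sequences.  Then [A] is
    equipotent to [G `*` nat], and a second factor [nat] is absorbed. *)
Lemma infinite_card_mul_nat (T : pointedType) (A : set T) : infinite_set A ->
  A `*` [set: nat] #<= A.
Proof.
move=> Ainf.
pose P (G : set (nat -> T)) :=
  (forall g n, G g -> A (g n)) /\
  (forall g h m n, G g -> G h -> g m = h n -> g = h /\ m = n).
have [F FP Ftot|G [[G1 G2] Gmax]] := @Zorn_bigcup _ P.
  split=> [g n [Y FY Yg]|g h m n [Y FY Yg] [Y' FY' Yh] gh].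
    exact: (FP _ FY).1.
  have [YY'|Y'Y] := Ftot _ _ FY FY'.
    by apply: (FP _ FY').2 gh => //; exact: YY'.
  by apply: (FP _ FY).2 gh => //; exact: Y'Y.
pose N := A `\` \bigcup_(g in G) range g.
have Nfin : finite_set N.
  apply: contrapT => /infiniteP/card_leE[g [gN ginj]].
  have Gg : ~ G g.
    by move=> Gg; have [_] := gN 0%N I; apply; exists g.
  apply: (Gmax (G `|` [set g])).
    split; first by left.
    by move=> /(_ g (or_intror erefl)).
  split=> [h n [Gh|->]|h k m n [Gh|->] [Gk|->]].
  - exact: G1.
  - by have [] := gN n I.
  - exact: G2.
  - move=> hg; have [_] := gN n I; case; exists h => //.
    by exists m.
  - move=> hg; have [_] := gN m I; case; exists k => //.
    by exists n.
  - by move=> /ginj -> .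
have [g0 Gg0] : G !=set0.
  apply/set0P/negP => /eqP G0; apply: Ainf.
  by move: Nfin; rewrite /N G0 bigcup_set0 setD0.
have [k kinj] : exists k : T -> nat, forall x y, N x -> N y -> k x = k y -> x = y.
  have /finite_set_countable/card_leE[k [_ kinj]] := Nfin.
  by exists k.
(* Even indices code the points of the sequences, odd ones the finite rest. *)
have AG : A #<= G `*` [set: nat].
  have /choice[c cP] : forall x, exists gn : (nat -> T) * nat, A x ->
      (N x /\ gn = (g0, (k x).*2.+1)) \/
      exists n, [/\ G gn.1, gn.2 = n.*2 & gn.1 n = x].
    move=> x; have [Nx|nNx] := pselect (N x); first by exists (g0, (k x).*2.+1); left.
    have [Ax|nAx] := pselect (A x); last by exists (g0, 0%N) => /nAx.
    have [g Gg [n _ gn]] : (\bigcup_(g in G) range g) x.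
      by apply: contrapT => h; exact: nNx.
    by exists (g, n.*2); right; exists n.
  apply: (@set_inj_card_le _ _ _ _ c) => [x /cP[[_ ->]|[n [Gc _ _]]]|x y Ax Ay cxy] //.
  have [[Nx cx]|[n [Gx x2 x1]]] := cP x Ax; have [[Ny cy]|[m [Gy y2 y1]]] := cP y Ay.
  - by move: cxy; rewrite cx cy => -[/double_inj/kinj]; exact.
  - by move: y2; rewrite -cxy cx/= => /(congr1 odd); rewrite /= !odd_double.
  - by move: x2; rewrite cxy cy/= => /(congr1 odd); rewrite /= !odd_double.
  - by rewrite -x1 -y1 cxy; congr (_ _); apply: double_inj; rewrite -x2 -y2 cxy.
have GA : G `*` [set: nat] #<= A.
  apply: (@set_inj_card_le _ _ _ _ (fun gn => gn.1 gn.2)).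
    by move=> [g n] [/= Gg _]; exact: G1.
  move=> [g n] [h m] [/= Gg _] [/= Gh _].
  by move=> /(G2 _ _ _ _ Gg Gh)[-> ->].
apply: card_le_trans GA.
have /card_leE[f [fAG finj]] := AG.
have /card_eqPle[/card_leE[p [_ pinj]] _] := card_nat2.
apply: (@set_inj_card_le _ _ _ _ (fun an => ((f an.1).1, p ((f an.1).2, an.2)))).
  by move=> [a n] [/= Aa _]; split=> //=; have [] := fAG _ Aa.
move=> [a n] [b m] [/= Aa _] [/= Ab _] [f1 /(pinj _ _ I I)[f2 <-]].
by congr pair; apply: finj => //; rewrite [LHS]surjective_pairing f1 f2 -surjective_pairing.
Qed.

Lemma infinite_bigcup_card_le (T U : pointedType) I (A : set T) (D : set I)
    (F : I -> set U) :
  infinite_set A -> D #<= A -> (forall i, D i -> countable (F i)) ->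
  \bigcup_(i in D) F i #<= A.
Proof.
move=> Ainf /card_leE[f [fDA finj]] cF.
apply: card_le_trans (infinite_card_mul_nat Ainf).
have /choice[g gP] : forall i, exists g : U -> nat, D i ->
    forall x y, F i x -> F i y -> g x = g y -> x = y.
  move=> i; have [/cF/card_leE[g [_ gP]]|nD] := pselect (D i); last by exists (fun=> 0%N).
  by exists g.
have [->|[x0 [i0 Di0 _]]] : \bigcup_(i in D) F i = set0 \/ \bigcup_(i in D) F i !=set0.
  by have [|/set0P] := eqVneq (\bigcup_(i in D) F i) set0; [left|right].
  exact: card_ge0.
have /choice[c cP] : forall x, exists i, (\bigcup_(i in D) F i) x -> D i /\ F i x.
  move=> x; have [[i Di Fx]|n] := pselect ((\bigcup_(i in D) F i) x); first by exists i.
  by exists i0.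
apply: (@set_inj_card_le _ _ _ _ (fun x => (f (c x), g (c x) x))).
  by move=> x /cP[Dx _]; split=> //=; exact: fDA.
move=> x y /cP[Dx Fx] /cP[Dy Fy] [/finj cxy].
by rewrite -cxy //; apply: gP => //; rewrite cxy.
Qed.

Lemma countable_bigcup_card_le (T U : pointedType) (A : set T) (F : nat -> set U) :
  infinite_set A -> (forall n, F n #<= A) -> \bigcup_n F n #<= A.
Proof.
move=> Ainf FA; apply: card_le_trans (infinite_card_mul_nat Ainf).
have /choice[f fP] : forall n, exists f : U -> T, (forall x, F n x -> A (f x)) /\
    forall x y, F n x -> F n y -> f x = f y -> x = y.
  by move=> n; apply: card_leE.
have /choice[c cP] : forall x, exists n, (\bigcup_n F n) x -> F n x.
  move=> x; have [[n _ Fx]|nF] := pselect ((\bigcup_n F n) x); first by exists n.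
  by exists 0%N.
apply: (@set_inj_card_le _ _ _ _ (fun x => (f (c x) x, c x))).
  by move=> x /cP Fx; split=> //=; exact: (fP _).1.
move=> x y /cP Fx /cP Fy [+ cxy]; rewrite -cxy in Fy *.
exact: (fP _).2.
Qed.

Lemma card_ltW T U (A : set T) (B : set U) : card_lt A B -> A #<= B.
Proof. by move=> /andP[]. Qed.

Lemma card_ltP T U (A : set T) (B : set U) :
  card_lt A B <-> A #<= B /\ ~ (B #<= A).
Proof.
rewrite /card_lt card_eq_le; split=> [/andP[AB]|[AB nBA]].
  by rewrite AB/= => /negP.
by rewrite AB/=; apply/negP.
Qed.

Lemma card_le_lt_trans T U V (A : set T) (B : set U) (C : set V) :
  A #<= B -> card_lt B C -> card_lt A C.
Proof.
move=> AB /card_ltP[BC nCB]; apply/card_ltP; split; first exact: card_le_trans BC.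
by move=> CA; apply: nCB; exact: card_le_trans AB.
Qed.

Lemma finite_card_lt T U (A : set T) (B : set U) :
  finite_set A -> infinite_set B -> card_lt A B.
Proof.
move=> Afin Binf; apply/card_ltP; split; last first.
  by move=> BA; apply: Binf; exact: card_le_finite BA Afin.
by move/infiniteP: Binf; apply: card_le_trans; exact: finite_set_countable.
Qed.

Lemma card_ltNge (T : pointedType) (A B : set T) : ~ card_lt A B -> B #<= A.
Proof.
by move=> nAB; have [AB|//] := card_le_total A B; apply: contrapT => nBA; apply/nAB/card_ltP.
Qed.

Lemma card_lt_setU (T : pointedType) U (A B : set T) (C : set U) : infinite_set C ->
  card_lt A C -> card_lt B C -> card_lt (A `|` B) C.
Proof.
wlog AB : A B / A #<= B.
  move=> h Cinf AC BC; have [AB|BA] := card_le_total A B; first exact: h.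
  by rewrite setUC; exact: h.
move=> Cinf AC BC; have [Bfin|Binf] := pselect (finite_set B).
  apply: finite_card_lt => //; rewrite finite_setU; split=> //.
  exact: card_le_finite AB Bfin.
apply: card_le_lt_trans BC.
rewrite -(_ : \bigcup_n (if n == 0%N then A else B) = A `|` B).
  by apply: countable_bigcup_card_le => // -[|n].
apply/seteqP; split=> [x [[|n] _ /=]|x [Ax|Bx]]; [by left|by right|..].
  by exists 0%N.
by exists 1%N.
Qed.

(** * Real-valued norms, closure and completeness *)

(** Norms of [H] take values in [R[i]], which is only partially ordered; the
    estimates are carried out in [R]. *)
Definition nrm (R : realType) (V : normedZmodType R[i]) (x : V) : R :=
  complex.Re `|x|.

Section RealNorm.
Context {R : realType}.

Lemma normE (V : normedZmodType R[i]) (x : V) : `|x| = (nrm x)%:C.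
Proof. by rewrite /nrm RRe_real // normr_real. Qed.

Section Zmod.
Context {V : normedZmodType R[i]}.
Implicit Types x y z : V.

Lemma nrm_ge0 x : 0 <= nrm x.
Proof. by rewrite -lecR -normE normr_ge0. Qed.

Lemma nrm0 : nrm (0 : V) = 0.
Proof. by rewrite /nrm normr0. Qed.

Lemma nrm_eq0 x : (nrm x == 0) = (x == 0).
Proof. by rewrite -(normr_eq0 x) normE -(inj_eq (@complexI R)). Qed.

Lemma nrm_gt0 x : (0 < nrm x) = (x != 0).
Proof. by rewrite lt_def nrm_ge0 andbT nrm_eq0. Qed.

Lemma nrmN x : nrm (- x) = nrm x.
Proof. by rewrite /nrm normrN. Qed.

Lemma nrmBC x y : nrm (x - y) = nrm (y - x).
Proof. by rewrite -nrmN opprB. Qed.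

Lemma nrmD x y : nrm (x + y) <= nrm x + nrm y.
Proof. by rewrite -lecR rmorphD/= -!normE ler_normD. Qed.

Lemma nrm_dist z x y : nrm (x - y) <= nrm (x - z) + nrm (z - y).
Proof. by rewrite (_ : x - y = (x - z) + (z - y)) ?nrmD // addrA subrK. Qed.

Lemma le_nrm_dist x y : nrm x <= nrm y + nrm (x - y).
Proof. by rewrite -{1}(subrK y x) addrC nrmD. Qed.

Lemma nrm_small_eq x y : (forall e : R, 0 < e -> nrm (x - y) <= e) -> x = y.
Proof.
move=> h; apply/eqP; rewrite -subr_eq0 -nrm_eq0 eq_le nrm_ge0 andbT.
by apply/ler_addgt0Pl => e e0; rewrite addr0; exact: h.
Qed.

End Zmod.

Lemma nrmM (a b : R[i]) : nrm (a * b) = nrm a * nrm b.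
Proof. by apply: complexI; rewrite rmorphM/= -!normE normrM. Qed.

Lemma nrmZ (V : normedModType R[i]) (a : R[i]) (x : V) :
  nrm (a *: x) = nrm a * nrm x.
Proof. by apply: complexI; rewrite rmorphM/= -!normE normrZ. Qed.

Lemma nrmR (a : R) : nrm (a%:C : R[i]) = `|a|.
Proof.
by rewrite /nrm normc_def /= expr0n /= addr0 sqrtr_sqr.
Qed.

Lemma Re_le_nrm (a : R[i]) : complex.Re a <= nrm a.
Proof.
apply: le_trans (ler_norm _) _.
by rewrite -lecR -normE; exact: normc_ge_Re.
Qed.

Lemma nrm_conj (a : R[i]) : nrm (Num.conj a) = nrm a.
Proof. by rewrite /nrm norm_conjC. Qed.

Lemma nrmV (a : R[i]) : nrm a^-1 = (nrm a)^-1.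
Proof. by apply: complexI; rewrite -normE normfV normE fmorphV. Qed.

Lemma le_of_sqr_le (a b : R) : 0 <= b -> a ^+ 2 <= b ^+ 2 -> a <= b.
Proof.
move=> b0 ab; rewrite leNgt; apply/negP => ba; move: ab; apply/negP; rewrite -ltNge.
by rewrite ltrXn2r // (le_lt_trans b0).
Qed.

End RealNorm.

Section Metric.
Context {R : realType} {H : completeNormedModType R[i]}.
Implicit Types (V : set H) (x y : H).

Lemma closure_nrmP V x :
  closure V x <-> forall e : R, 0 < e -> exists2 v, V v & nrm (x - v) < e.
Proof.
split=> [cV e e0|h B /nbhs_ballP[e /= e0 eB]].
  have e0C : 0 < e%:C :> R[i] by rewrite ltcR.
  have [v [Vv]] := cV _ (nbhsx_ballx x _ e0C).
  by rewrite -ball_normE /= normE ltcR; exists v.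
have eR : e = (complex.Re e)%:C by rewrite RRe_real // gtr0_real.
have [|v Vv xv] := h (complex.Re e); first by rewrite -ltcR -eR.
exists v; split=> //; apply: eB; rewrite -ball_normE /= normE eR ltcR.
exact: xv.
Qed.

Lemma complete_nrm (u : nat -> H) :
  (forall e : R, 0 < e -> exists N, forall n m, (N <= n)%N -> (N <= m)%N ->
     nrm (u n - u m) < e) ->
  exists l, forall e : R, 0 < e -> exists N, forall n, (N <= n)%N -> nrm (u n - l) < e.
Proof.
move=> cu; have : cvg (u @ \oo).
  apply: cauchy_cvg; apply/cauchyP => e e0.
  have eR : e = (complex.Re e)%:C by rewrite RRe_real // gtr0_real.
  have [|N uN] := cu (complex.Re e); first by rewrite -ltcR -eR.
  exists (u N); exists N => // n /= Nn.
  by rewrite -ball_normE /= normE eR ltcR; exact: uN.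
move=> /cvgrPdist_lt cvgu; exists (lim (u @ \oo)) => e e0.
have [|N _ uN] := cvgu e%:C; first by rewrite ltcR.
by exists N => n Nn; move: (uN n Nn) => /=; rewrite normE ltcR nrmBC.
Qed.

End Metric.

(** * Subspaces, bounded operators and the inner product *)

Section Subspaces.
Context {R : realType} {H : completeNormedModType R[i]}.
Implicit Types (V B : set H) (x y : H).

Lemma sub_lin_span B : B `<=` lin_span B.
Proof. by move=> x Bx V [_]; apply. Qed.

Lemma lin_span_min B V : subspace_of_hilbert V -> B `<=` V -> lin_span B `<=` V.
Proof. by move=> sV BV x; apply. Qed.

Lemma lin_span_subspace B : subspace_of_hilbert (lin_span B).
Proof.
split=> [V [[]]//|c x y Bx By V sBV].
by case: (sBV) => -[_ lV] _; apply: lV; [exact: Bx|exact: By].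
Qed.

Lemma lin_spanS B B' : B `<=` B' -> lin_span B `<=` lin_span B'.
Proof.
by move=> BB'; apply: lin_span_min (lin_span_subspace _) _ => x /BB'/sub_lin_span.
Qed.

Section Closed.
Variable V : set H.
Hypothesis sV : subspace_of_hilbert V.

Lemma subspace0 : V 0. Proof. by case: sV. Qed.

Lemma subspaceD x y : V x -> V y -> V (x + y).
Proof. by move=> Vx Vy; rewrite -(scale1r x); exact: sV.2. Qed.

Lemma subspaceZ a x : V x -> V (a *: x).
Proof. by move=> Vx; rewrite -[_ *: _]addr0; apply: sV.2 => //; exact: subspace0. Qed.

Lemma subspaceB x y : V x -> V y -> V (x - y).
Proof. by move=> Vx Vy; rewrite -scaleN1r addrC; exact: sV.2. Qed.

Lemma subspace_sum (s : seq H) (f : H -> H) :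
  (forall x, x \in s -> V (f x)) -> V (\sum_(x <- s) f x).
Proof.
by move=> h; rewrite big_seq; elim/big_ind: _ => //; [exact: subspace0|exact: subspaceD].
Qed.

Lemma closure_subspace : subspace_of_hilbert (closure V).
Proof.
split; first exact/subset_closure/subspace0.
move=> c x y /closure_nrmP cx /closure_nrmP cy; apply/closure_nrmP => e e0.
pose k := nrm c + 1; have k0 : 0 < k by have := nrm_ge0 c; rewrite /k; lra.
have [|x' Vx' xx'] := cx (e / 2 / k); first by rewrite !divr_gt0.
have [|y' Vy' yy'] := cy (e / 2); first by rewrite divr_gt0.
exists (c *: x' + y'); first exact: sV.2.
rewrite (_ : _ - _ = c *: (x - x') + (y - y')); last first.
  by rewrite scalerBr opprD addrACA.
apply: le_lt_trans (nrmD _ _) _; rewrite nrmZ (splitr e); apply: ler_ltD yy'.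
apply: (@le_trans _ _ (k * nrm (x - x'))).
  by apply: ler_wpM2r; [exact: nrm_ge0|rewrite /k; lra].
by rewrite mulrC -ler_pdivlMr // ltW.
Qed.

End Closed.

Lemma closure_closure V : closure (closure V) = closure V.
Proof. exact: (esym ((closure_id _).1 (@closed_closure _ _))). Qed.

Lemma closure_lin_span_min B V : subspace_of_hilbert V -> closure V = V -> B `<=` V ->
  closure (lin_span B) `<=` V.
Proof. by move=> sV cV BV; rewrite -cV; apply: closureS; exact: lin_span_min. Qed.

Lemma sub_closure_lin_span B : B `<=` closure (lin_span B).
Proof. by move=> x Bx; apply: subset_closure; exact: sub_lin_span. Qed.

Lemma closure_lin_span_subspace B : subspace_of_hilbert (closure (lin_span B)).
Proof. by apply: closure_subspace; exact: lin_span_subspace. Qed.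

Lemma bounded_opP (A : H -> H) : bounded_op A <->
  linear A /\ exists2 M, 0 < M & forall x, nrm (A x) <= M * nrm x.
Proof.
split=> [[lA [M AM]]|[lA [M _ AM]]]; split=> //.
  exists (Num.max M 1); first by rewrite lt_max ltr01 orbT.
  move=> x; have := AM x; rewrite !normE -rmorphM /= lecR => /le_trans; apply.
  by apply: ler_wpM2r; [exact: nrm_ge0|rewrite le_max lexx].
by exists M => x; rewrite !normE -rmorphM /= lecR.
Qed.

Section Linear.
Variable A : H -> H.
Hypothesis lA : linear A.

Lemma lin0 : A 0 = 0.
Proof. by have := lA 1 0 0; rewrite !scale1r !addr0 -[X in X = _]addr0 => /addrI. Qed.

Lemma linD x y : A (x + y) = A x + A y.
Proof. by rewrite -(scale1r x) lA !scale1r. Qed.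

Lemma linZ a x : A (a *: x) = a *: A x.
Proof. by rewrite -[a *: x]addr0 lA lin0 addr0. Qed.

Lemma linB x y : A (x - y) = A x - A y.
Proof. by rewrite -scaleN1r addrC lA scaleN1r addrC. Qed.

Lemma range_subspace : subspace_of_hilbert (range A).
Proof.
split; first by exists 0 => //; exact: lin0.
by move=> c _ _ [x _ <-] [y _ <-]; exists (c *: x + y) => //; rewrite lA.
Qed.

Lemma lin_span_image B x : lin_span B x -> lin_span (A @` B) (A x).
Proof.
suff : lin_span B `<=` [set x | lin_span (A @` B) (A x)] by apply.
apply: lin_span_min.
  split=> [|c u v] /=; first by rewrite lin0; apply: subspace0; exact: lin_span_subspace.
  by move=> Au Av; rewrite lA; apply: (lin_span_subspace _).2.
by move=> b Bb; apply: sub_lin_span; exists b.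
Qed.

End Linear.

Lemma bounded_linear (A : H -> H) : bounded_op A -> linear A.
Proof. by case. Qed.

Lemma bounded_comp (S T : H -> H) : bounded_op S -> bounded_op T -> bounded_op (S \o T).
Proof.
move=> /bounded_opP[lS [M M0 SM]] /bounded_opP[lT [N N0 TN]]; apply/bounded_opP.
split=> [c x y|]; first by rewrite /= lT lS.
exists (M * N); first exact: mulr_gt0.
by move=> x /=; apply: le_trans (SM _) _; rewrite -mulrA ler_pM2l.
Qed.

Lemma bounded_add (S T : H -> H) : bounded_op S -> bounded_op T -> bounded_op (S + T).
Proof.
move=> /bounded_opP[lS [M M0 SM]] /bounded_opP[lT [N N0 TN]]; apply/bounded_opP.
split=> [c x y|].
  rewrite (_ : (S + T) _ = S (c *: x + y) + T (c *: x + y)) // lT lS.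
  by rewrite addrACA -scalerDr.
exists (M + N); first exact: addr_gt0.
by move=> x /=; apply: le_trans (nrmD _ _) _; rewrite mulrDl lerD.
Qed.

Lemma bounded_scale c (S : H -> H) : bounded_op S -> bounded_op (c *: S).
Proof.
move=> /bounded_opP[lS [M M0 SM]]; apply/bounded_opP.
split=> [a x y|].
  rewrite (_ : (c *: S) _ = c *: S (a *: x + y)) // lS scalerDr.
  by rewrite scalerA mulrC -scalerA.
exists (Num.max (nrm c * M) 1); first by rewrite lt_max ltr01 orbT.
move=> x /=; rewrite (_ : (c *: S) x = c *: S x) // nrmZ.
apply: (@le_trans _ _ (nrm c * M * nrm x)).
  by rewrite -mulrA; apply: ler_wpM2l => //; exact: nrm_ge0.
by apply: ler_wpM2r; [exact: nrm_ge0|rewrite le_max lexx].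
Qed.

Lemma bounded0 : bounded_op (0 : H -> H).
Proof.
apply/bounded_opP; split=> [a x y|]; first by rewrite scaler0 addr0.
by exists 1 => // x; rewrite nrm0 mul1r nrm_ge0.
Qed.

Lemma bounded_id : bounded_op (idfun : H -> H).
Proof. by apply/bounded_opP; split=> //; exists 1 => // x; rewrite mul1r. Qed.

Lemma bounded_closure (A : H -> H) V W x : bounded_op A ->
  (forall v, V v -> closure W (A v)) ->
  closure V x -> closure W (A x).
Proof.
move=> /bounded_opP[lA [M M0 AM]] VW /closure_nrmP Vx.
rewrite -(closure_closure W); apply/closure_nrmP => e e0.
have [|v Vv xv] := Vx (e / M); first by rewrite divr_gt0.
exists (A v); first exact: VW.
rewrite -(linB lA); apply: le_lt_trans (AM _) _.
by rewrite mulrC -ltr_pdivlMr.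
Qed.

Lemma bounded_closure_span (A : H -> H) B Y x : bounded_op A -> (forall b, B b -> Y (A b)) ->
  closure (lin_span B) x -> closure (lin_span Y) (A x).
Proof.
move=> bA BY; apply: (bounded_closure bA) => v Bv; apply: subset_closure.
have : lin_span (A @` B) (A v) by apply: lin_span_image => //; exact: bounded_linear.
by apply: lin_spanS => _ [b Bb <-]; exact: BY.
Qed.

Lemma eq_on_closure_span B (S T : H -> H) : bounded_op S -> bounded_op T ->
  (forall b, B b -> S b = T b) -> forall x, closure (lin_span B) x -> S x = T x.
Proof.
move=> /bounded_opP[lS [M M0 SM]] /bounded_opP[lT [N N0 TN]] ST.
suff : closure (lin_span B) `<=` [set x | S x = T x] by [].
apply: closure_lin_span_min => //.
  split=> [|c x y] /=; first by rewrite !lin0.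
  by rewrite lS lT => -> ->.
apply/seteqP; split=> [x /closure_nrmP cx|]; last exact: subset_closure.
apply: nrm_small_eq => e e0.
have [|v /= Sv xv] := cx (e / (M + N)); first by rewrite divr_gt0 // addr_gt0.
apply: le_trans (nrm_dist (S v) _ _) _; rewrite {2}Sv -(linB lS) -(linB lT).
apply: (@le_trans _ _ ((M + N) * nrm (x - v))).
  by rewrite mulrDl; apply: lerD; [exact: SM|rewrite (nrmBC x v); exact: TN].
by rewrite mulrC -ler_pdivlMr ?addr_gt0 // ltW.
Qed.

End Subspaces.

Section Dot.
Context {R : realType} {H : completeNormedModType R[i]}.
Variable dot : {dot H for Num.conj}.
Hypothesis Hdot : norm_from_dot dot.
Implicit Types (V B C : set H) (x y : H).

Lemma dotDl x y z : dot (x + y) z = dot x z + dot y z.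
Proof. exact: linearDl. Qed.
Lemma dotDr x y z : dot z (x + y) = dot z x + dot z y.
Proof. exact: linearDr. Qed.
Lemma dotBl x y z : dot (x - y) z = dot x z - dot y z.
Proof. exact: linearBl. Qed.
Lemma dotBr x y z : dot z (x - y) = dot z x - dot z y.
Proof. exact: linearBr. Qed.
Lemma dotZl a x y : dot (a *: x) y = a * dot x y.
Proof. exact: linearZl_LR. Qed.
Lemma dotZr a x y : dot x (a *: y) = Num.conj a * dot x y.
Proof. exact: linearZr_LR. Qed.
Lemma dot0l x : dot 0 x = 0.
Proof. exact: linear0l. Qed.
Lemma dot0r x : dot x 0 = 0.
Proof. exact: linear0r. Qed.
Lemma dot_suml (s : seq H) (f : H -> H) z :
  dot (\sum_(x <- s) f x) z = \sum_(x <- s) dot (f x) z.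
Proof. by apply: (big_morph (dot^~ z)) => [x y|]; [exact: dotDl|exact: dot0l]. Qed.

Lemma dot_conj x y : dot x y = Num.conj (dot y x).
Proof. by rewrite hermC expr0 mul1r. Qed.

Lemma dot_eq0_sym x y : dot x y = 0 -> dot y x = 0.
Proof. by move=> xy; rewrite dot_conj xy conjC0. Qed.

Lemma dotxx x : dot x x = (nrm x ^+ 2)%:C.
Proof. by rewrite -Hdot normE rmorphXn. Qed.

Lemma nrm_sqr x : nrm x ^+ 2 = complex.Re (dot x x).
Proof. by rewrite dotxx. Qed.

Lemma unit_nrm x : dot x x = 1 <-> nrm x = 1.
Proof.
rewrite dotxx; split=> [[]/(congr1 Num.sqrt)|->]; last by rewrite expr1n.
by rewrite sqrtr_sqr sqrtr1 ger0_norm // nrm_ge0.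
Qed.

Lemma pythagoras x y : dot x y = 0 -> nrm (x + y) ^+ 2 = nrm x ^+ 2 + nrm y ^+ 2.
Proof.
move=> xy; apply: complexI; rewrite rmorphD/= -!dotxx dotDl !dotDr xy.
by rewrite (dot_eq0_sym xy) addr0 add0r.
Qed.

Lemma cauchy_schwarz x y : nrm (dot x y) <= nrm x * nrm y.
Proof.
have [->|y0] := eqVneq y 0; first by rewrite dot0r !nrm0 mulr0.
pose c := dot x y / dot y y.
have yy0 : dot y y != 0 by rewrite dotxx fmorph_eq0 sqrf_eq0 nrm_eq0.
have o : dot (x - c *: y) (c *: y) = 0.
  by rewrite dotZr dotBl dotZl /c divfK // subrr mulr0.
have := pythagoras o; rewrite subrK nrmZ /c nrmM nrmV dotxx nrmR ger0_norm ?sqr_ge0 //.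
have n0 : nrm y != 0 by rewrite nrm_eq0.
set w := _ / _ * nrm y => h; have -> : nrm (dot x y) = w * nrm y by rewrite /w; field.
clearbody w.
apply: le_of_sqr_le; first by rewrite mulr_ge0 ?nrm_ge0.
by rewrite !exprMn ler_wpM2r ?sqr_ge0 // h lerDr sqr_ge0.
Qed.

End Dot.

(** * Bessel series, diagonal operators and orthogonal projections *)

Lemma big_fset_split (T : choiceType) (V : zmodType) (s t : {fset T}) (g : T -> V) :
  {subset s <= t} ->
  \sum_(x <- t) g x = \sum_(x <- s) g x + \sum_(x <- [seq x <- t | x \notin s]) g x.
Proof.
move=> st; rewrite -big_cat; apply/perm_big/uniq_perm => //.
  rewrite cat_uniq fset_uniq filter_uniq //= andbT.
  by apply/hasPn => x; rewrite mem_filter => /andP[].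
move=> x; rewrite mem_cat mem_filter; case xs: (x \in s) => //=.
by rewrite st.
Qed.

Section Sums.
Context {R : realType} {H : completeNormedModType R[i]}.
Variable dot : {dot H for Num.conj}.
Hypothesis Hdot : norm_from_dot dot.
Implicit Types (V B C : set H) (x y : H).

Definition perp B : set H := [set x | forall b, B b -> dot x b = 0].

Lemma perp_subspace B : subspace_of_hilbert (perp B).
Proof.
split=> [b _|c x y px py b Bb]; first exact: dot0l.
by rewrite dotDl dotZl px // py // mulr0 addr0.
Qed.

Lemma nrm_dot_approx x y b e : 0 <= e -> nrm (x - y) <= e ->
  nrm (dot x b - dot y b) <= e * nrm b.
Proof.
move=> e0 xy; rewrite -dotBl; apply: le_trans (cauchy_schwarz Hdot _ _) _.
by apply: ler_wpM2r => //; exact: nrm_ge0.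
Qed.

(** Continuity of the inner product in its first argument, for a value that is
    attained arbitrarily close to [x]. *)
Lemma dot_limit x b a :
  (forall e : R, 0 < e -> exists2 y, nrm (x - y) <= e & dot y b = a) -> dot x b = a.
Proof.
move=> h; apply: nrm_small_eq => e e0.
pose k := nrm b + 1; have k0 : 0 < k by have := nrm_ge0 b; rewrite /k; lra.
have [|y xy <-] := h (e / k); first by rewrite divr_gt0.
apply: le_trans (nrm_dot_approx b _ xy) _; first by rewrite ltW // divr_gt0.
rewrite mulrAC ler_pdivrMr // ler_wpM2l //; first exact: ltW.
by rewrite /k lerDl.
Qed.

Lemma perp_closed B : closure (perp B) = perp B.
Proof.
apply/seteqP; split; last exact: subset_closure.
move=> x /closure_nrmP px b Bb; apply: dot_limit => e /px[v pv xv].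
by exists v; [exact: ltW|exact: pv].
Qed.

Lemma perp_sym B C : (C `<=` perp B) -> (B `<=` perp C).
Proof. by move=> CB b Bb c Cc; apply: dot_eq0_sym; exact: CB. Qed.

Lemma perp_closure_span B : perp (closure (lin_span B)) = perp B.
Proof.
apply/seteqP; split=> x px b Bb; first exact/px/sub_closure_lin_span.
apply: dot_eq0_sym.
suff /(_ _ Bb)/(_ x erefl) : closure (lin_span B) `<=` perp [set x] by [].
apply: closure_lin_span_min; [exact: perp_subspace|exact: perp_closed|].
by apply: perp_sym => _ ->.
Qed.

Lemma perp_span B x y : perp B x -> lin_span B y -> dot x y = 0.
Proof.
by rewrite -perp_closure_span => px By; apply: px; exact: subset_closure.
Qed.

Lemma perp_closure_eq0 B x : closure (lin_span B) x -> perp B x -> x = 0.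
Proof.
rewrite -perp_closure_span => Bx /(_ _ Bx) xx.
by apply/eqP; rewrite -nrm_eq0 -sqrf_eq0 (nrm_sqr Hdot) xx.
Qed.

Lemma orthonormal_nrm B b : orthonormal_set dot B -> B b -> nrm b = 1.
Proof. by move=> oB Bb; apply/(unit_nrm Hdot); rewrite oB // eqxx. Qed.

Lemma orthonormal_sub B C : C `<=` B -> orthonormal_set dot B -> orthonormal_set dot C.
Proof. by move=> CB oB x y /CB Bx /CB By; exact: oB. Qed.

Definition orthogonal_on B (f : H -> H) :=
  forall b c, B b -> B c -> b != c -> dot (f b) (f c) = 0.

Lemma orthonormal_on B : orthonormal_set dot B -> orthogonal_on B id.
Proof. by move=> oB b c Bb Bc /negPf bc; rewrite oB // bc. Qed.

Lemma nrm_sum_sqr B f (s : seq H) : orthogonal_on B f -> uniq s ->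
  (forall b, b \in s -> B b) ->
  nrm (\sum_(b <- s) f b) ^+ 2 = \sum_(b <- s) nrm (f b) ^+ 2.
Proof.
move=> ofC; elim: s => [|b s IH]/=; first by rewrite !big_nil nrm0 expr0n.
move=> /andP[bs us] sB; rewrite !big_cons.
rewrite (pythagoras Hdot); last first.
  apply: dot_eq0_sym; rewrite dot_suml big_seq big1 // => c cs.
  by apply: ofC; [exact/sB/mem_behead|exact/sB/mem_head|apply: contraNneq bs => <-].
by rewrite IH // => c cs; exact/sB/mem_behead.
Qed.

Lemma orthogonal_onZ B f (a : H -> R[i]) :
  orthogonal_on B f -> orthogonal_on B (fun b => a b *: f b).
Proof. by move=> ofC b c Bb Bc bc; rewrite dotZl dotZr ofC // !mulr0. Qed.

Lemma bessel B x (s : seq H) : orthonormal_set dot B -> uniq s ->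
  (forall b, b \in s -> B b) ->
  \sum_(b <- s) nrm (dot x b) ^+ 2 <= nrm x ^+ 2.
Proof.
move=> oB us sB; pose p := \sum_(b <- s) dot x b *: b.
have pb b : b \in s -> dot p b = dot x b.
  move=> bs; have Bb := sB _ bs.
  rewrite dot_suml (bigD1_seq b) //= dotZl (oB b b) // eqxx mulr1.
  rewrite big_seq_cond big1 ?addr0 // => c /andP[cs cb].
  by rewrite dotZl (oB c b) // ?(negPf cb) ?mulr0 //; exact: sB.
have o : dot (x - p) p = 0.
  apply: dot_eq0_sym; rewrite {1}/p dot_suml big_seq big1 // => b bs.
  rewrite dotZl [X in _ * X](_ : _ = 0) ?mulr0 //.
  by apply: dot_eq0_sym; rewrite dotBl pb // subrr.
have := pythagoras Hdot o; rewrite subrK => ->.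
rewrite (nrm_sum_sqr (orthogonal_onZ (dot x) (orthonormal_on oB)) us sB).
rewrite [leLHS](_ : _ = \sum_(b <- s) nrm (dot x b *: b) ^+ 2) ?lerDr ?sqr_ge0 //.
apply: eq_big_seq => b /sB Bb.
by rewrite nrmZ (orthonormal_nrm oB Bb) mulr1.
Qed.

Definition fin_in C (s : {fset H}) := forall c, c \in s -> C c.

Definition fsum (f : H -> H) x (s : {fset H}) := \sum_(c <- s) dot x c *: f c.

(** [y] is the sum of the series of the [dot x c *: f c] along the directed set
    of finite parts of [C]. *)
Definition fourier_sum C (f : H -> H) x y :=
  forall e : R, 0 < e -> exists2 s, fin_in C s &
    forall t, fin_in C t -> {subset s <= t} -> nrm (y - fsum f x t) <= e.

Lemma fin_inU C s t : fin_in C s -> fin_in C t -> fin_in C (s `|` t)%fset.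
Proof. by move=> sC tC c; rewrite inE => /orP[/sC|/tC]. Qed.

Lemma subset_fsetUl (s t : {fset H}) : {subset s <= (s `|` t)%fset}.
Proof. by move=> x xs; rewrite inE xs. Qed.

Lemma subset_fsetUr (s t : {fset H}) : {subset t <= (s `|` t)%fset}.
Proof. by move=> x xs; rewrite inE xs orbT. Qed.

Section Fourier.
Variables (C : set H) (f : H -> H) (K : R).
Hypotheses (oC : orthonormal_set dot C) (ofC : orthogonal_on C f).
Hypotheses (K0 : 0 < K) (fK : forall c, C c -> nrm (f c) <= K).

(** By orthogonality of the [f c], tails of the series are controlled by the
    tails of the Bessel sum of [x]. *)
Lemma fsum_tail x s t : fin_in C t -> {subset s <= t} ->
  nrm (fsum f x t - fsum f x s) ^+ 2 <=
  K ^+ 2 * (\sum_(c <- t) nrm (dot x c) ^+ 2 - \sum_(c <- s) nrm (dot x c) ^+ 2).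
Proof.
move=> tC st; rewrite /fsum !(big_fset_split _ st) /= addrAC subrr add0r.
rewrite [X in _ * X]addrAC subrr add0r.
set r := [seq _ <- _ | _]; have rC c : c \in r -> C c.
  by rewrite mem_filter => /andP[_ /tC].
have ur : uniq r by rewrite filter_uniq ?fset_uniq.
rewrite (nrm_sum_sqr (orthogonal_onZ (dot x) ofC) ur rC).
rewrite mulr_sumr big_seq [leRHS]big_seq; apply: ler_sum => c /rC Cc.
rewrite nrmZ exprMn mulrC ler_wpM2r ?sqr_ge0 //.
by rewrite ler_sqr ?nnegrE ?nrm_ge0 ?fK // ltW.
Qed.

(** The supremum of the Bessel sums is finite, and a finite part that nearly
    attains it leaves a small tail. *)
Lemma bessel_tail x (e : R) : 0 < e -> exists2 s, fin_in C s &
  forall t, fin_in C t -> {subset s <= t} ->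
  \sum_(c <- t) nrm (dot x c) ^+ 2 - \sum_(c <- s) nrm (dot x c) ^+ 2 < e.
Proof.
move=> e0; pose S := [set \sum_(c <- s) nrm (dot x c) ^+ 2 | s in fin_in C].
have supS : has_sup S.
  split; first by exists (\sum_(c <- (fset0 : {fset H})) nrm (dot x c) ^+ 2); exists fset0.
  by exists (nrm x ^+ 2) => _ [s sC <-]; exact: (bessel x oC (fset_uniq s) sC).
have [_ [s sC <-] ls] := sup_adherent e0 supS.
exists s => // t tC st; rewrite ltrBlDl -ltrBlDr.
apply: le_lt_trans ls; rewrite lerD2r.
by apply: ub_le_sup; [exact: supS.2|exists t].
Qed.

Lemma fourier_sum_exists x : exists y, fourier_sum C f x y.
Proof.
have tail e : 0 < e -> exists2 s, fin_in C s &
    forall t, fin_in C t -> {subset s <= t} -> nrm (fsum f x t - fsum f x s) <= e.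
  move=> e0; have [|s sC sP] := @bessel_tail x ((e / K) ^+ 2).
    by rewrite exprn_gt0 // divr_gt0.
  exists s => // t tC st; apply: le_of_sqr_le; first exact: ltW.
  apply: le_trans (fsum_tail x tC st) _.
  have -> : e ^+ 2 = K ^+ 2 * (e / K) ^+ 2 by have n0 := lt0r_neq0 K0; field.
  by rewrite ler_pM2l ?exprn_gt0 // ltW // sP.
have /choice[s sP] : forall n : nat, exists s, fin_in C s /\
    forall t, fin_in C t -> {subset s <= t} ->
      nrm (fsum f x t - fsum f x s) <= n.+1%:R^-1.
  by move=> n; have [|s sC sP] := tail n.+1%:R^-1; [rewrite invr_gt0|exists s].
have small (e : R) : 0 < e -> exists N : nat, forall n, (N <= n)%N -> n.+1%:R^-1 < e.
  move=> e0; exists (Num.truncn e^-1) => n Nn.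
  rewrite invf_plt ?posrE //; apply: lt_le_trans (truncnS_gt _) _.
  by rewrite ler_nat.
have [|y yP] := @complete_nrm _ _ (fun n => fsum f x (s n)).
  move=> e e0; have [|N NP] := small (e / 2); first by rewrite divr_gt0.
  exists N => n m Nn Nm; apply: le_lt_trans (nrm_dist (fsum f x (s n `|` s m)%fset) _ _) _.
  rewrite (splitr e) nrmBC; apply: ltrD.
    apply: le_lt_trans (NP _ Nn); apply: (sP n).2; last exact: subset_fsetUl.
    by apply: fin_inU; [exact: (sP n).1|exact: (sP m).1].
  apply: le_lt_trans (NP _ Nm); apply: (sP m).2; last exact: subset_fsetUr.
  by apply: fin_inU; [exact: (sP n).1|exact: (sP m).1].
exists y => e e0.
have [|N NP] := small (e / 2); first by rewrite divr_gt0.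
have [|M MP] := yP (e / 2); first by rewrite divr_gt0.
pose n := maxn N M; exists (s n); first exact: (sP n).1.
move=> t tC st; apply: le_trans (nrm_dist (fsum f x (s n)) _ _) _.
rewrite (splitr e) nrmBC; apply: lerD; first by apply/ltW/MP/leq_maxr.
rewrite nrmBC; apply: le_trans ((sP n).2 t tC st) _.
by apply/ltW/NP/leq_maxl.
Qed.

Lemma fourier_sum_unique x y y' : fourier_sum C f x y -> fourier_sum C f x y' -> y = y'.
Proof.
move=> yP yP'; apply: nrm_small_eq => e e0.
have [|s sC sP] := yP (e / 2); first by rewrite divr_gt0.
have [|s' sC' sP'] := yP' (e / 2); first by rewrite divr_gt0.
pose t := (s `|` s')%fset; have tC : fin_in C t by exact: fin_inU.
apply: le_trans (nrm_dist (fsum f x t) _ _) _; rewrite (splitr e); apply: lerD.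
  by apply: sP => //; exact: subset_fsetUl.
by rewrite nrmBC; apply: sP' => //; exact: subset_fsetUr.
Qed.

Lemma fsum_linear c x x' t : fsum f (c *: x + x') t = c *: fsum f x t + fsum f x' t.
Proof.
rewrite /fsum scaler_sumr -big_split; apply: eq_bigr => b _.
by rewrite dotDl dotZl scalerDl scalerA.
Qed.

Lemma fourier_sum_linear c x x' y y' : fourier_sum C f x y -> fourier_sum C f x' y' ->
  fourier_sum C f (c *: x + x') (c *: y + y').
Proof.
move=> yP yP' e e0; pose k := nrm c + 1.
have k0 : 0 < k by have := nrm_ge0 c; rewrite /k; lra.
have [|s sC sP] := yP (e / 2 / k); first by rewrite !divr_gt0.
have [|s' sC' sP'] := yP' (e / 2); first by rewrite divr_gt0.
exists (s `|` s')%fset; first exact: fin_inU.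
move=> t tC st; rewrite fsum_linear opprD addrACA -scalerBr.
apply: le_trans (nrmD _ _) _; rewrite (splitr e) nrmZ; apply: lerD; last first.
  by apply: sP' => // u us; apply/st/subset_fsetUr.
apply: (@le_trans _ _ (k * nrm (y - fsum f x t))).
  by rewrite ler_wpM2r ?nrm_ge0 // /k lerDl.
rewrite mulrC -ler_pdivlMr //; apply: sP => // u us.
exact/st/subset_fsetUl.
Qed.

Lemma fourier_sum_bound x y : fourier_sum C f x y -> nrm y <= K * nrm x.
Proof.
move=> yP; apply/ler_addgt0Pl => e /yP[s sC /(_ s sC (fun _ => id)) ys].
apply: le_trans (le_nrm_dist y (fsum f x s)) _; rewrite addrC; apply: lerD => //.
apply: le_of_sqr_le; first by rewrite mulr_ge0 ?nrm_ge0 ?ltW.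
have n0 : {subset (fset0 : {fset H}) <= s} by [].
have := fsum_tail x sC n0; rewrite /fsum !big_seq_fset0 !subr0 => /le_trans; apply.
by rewrite exprMn ler_pM2l ?exprn_gt0 //; exact: (bessel x oC (fset_uniq s) sC).
Qed.

Lemma fourier_sum_perp x : perp C x -> fourier_sum C f x 0.
Proof.
move=> px e e0; exists fset0 => // t tC _.
by rewrite sub0r nrmN /fsum big_seq big1 ?nrm0 ?ltW // => c /tC/px ->; rewrite scale0r.
Qed.

Lemma fourier_sum_basis c : C c -> fourier_sum C f c (f c).
Proof.
move=> Cc e e0; exists [fset c]%fset; first by move=> d; rewrite inE => /eqP ->.
move=> t tC ct; have cint : c \in t by apply: ct; rewrite inE.
rewrite /fsum (big_fsetD1 c) //= oC // eqxx scale1r.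
rewrite big_seq big1 ?addr0 ?subrr ?nrm0 ?ltW // => d; rewrite !inE => /andP[dc /tC Cd].
by rewrite oC // eq_sym (negPf dc) scale0r.
Qed.

Lemma fourier_sum_closure x y : fourier_sum C f x y -> closure (lin_span (f @` C)) y.
Proof.
move=> yP; apply/closure_nrmP => e e0.
have [|s sC sP] := yP (e / 2); first by rewrite divr_gt0.
exists (fsum f x s); last first.
  by apply: le_lt_trans (sP s sC (fun _ => id)) _; rewrite ltr_pdivrMr // ltr_pMr // ltr1n.
apply: subspace_sum => [|c cs]; first exact: lin_span_subspace.
by apply: subspaceZ (lin_span_subspace _) _ _ _; apply: sub_lin_span; exists c => //; exact: sC.
Qed.

Lemma fourier_sum_dot x y c : fourier_sum C f x y -> C c ->
  dot y (f c) = dot x c * dot (f c) (f c).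
Proof.
move=> yP Cc; apply: dot_limit => e /yP[s sC sP].
have Ct : fin_in C (c |` s)%fset by move=> d; rewrite !inE => /orP[/eqP ->|/sC].
exists (fsum f x (c |` s)%fset).
  by apply: sP => // d ds; rewrite !inE ds orbT.
rewrite /fsum (big_fsetD1 c) /= ?inE ?eqxx // dotDl dotZl dot_suml.
rewrite big_seq big1 ?addr0 // => d; rewrite in_fsetD1 => /andP[dc /Ct Cd].
by rewrite dotZl ofC // mulr0.
Qed.

(** The operator that sends the orthonormal vectors [c] to the orthogonal
    vectors [f c] and vanishes on the orthogonal complement of [C].  All
    operators constructed below are of this kind: projections ([f = id]),
    partial isometries, and inverses on a subspace. *)
Lemma diagonal_op : exists S : H -> H,
  [/\ bounded_op S, forall c, C c -> S c = f c, forall x, perp C x -> S x = 0,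
      forall x, closure (lin_span (f @` C)) (S x)
    & forall x c, C c -> dot (S x) (f c) = dot x c * dot (f c) (f c)].
Proof.
have /choice[S SP] := fourier_sum_exists.
exists S; split.
- apply/bounded_opP; split.
    by move=> c x y; apply: fourier_sum_unique (SP _) _; exact: fourier_sum_linear.
  by exists K => // x; exact: fourier_sum_bound.
- by move=> c Cc; apply: fourier_sum_unique (SP _) _; exact: fourier_sum_basis.
- by move=> x px; apply: fourier_sum_unique (SP _) _; exact: fourier_sum_perp.
- by move=> x; exact: fourier_sum_closure.
- by move=> x c; exact: fourier_sum_dot.
Qed.

End Fourier.

Lemma projection_exists C : orthonormal_set dot C ->
  exists P : H -> H, [/\ bounded_op P, forall x, closure (lin_span C) (P x)
    & forall x, perp C (x - P x)].
Proof.
move=> oC; have [c Cc|P [bP _ _ CP Pd]] := diagonal_op oC (orthonormal_on oC) ltr01.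
  by rewrite (orthonormal_nrm oC).
exists P; split=> // [x|x c Cc]; first by rewrite -[C in lin_span C]image_id.
by rewrite dotBl (Pd _ _ Cc) (oC c c) // eqxx mulr1 subrr.
Qed.

Definition is_oproj C : set (H -> H) := [set P | [/\ bounded_op P,
  forall x, closure (lin_span C) (P x) & forall x, perp C (x - P x)]].

Definition oproj C : H -> H := xget 0 (is_oproj C).

Section Proj.
Variable C : set H.
Hypothesis oC : orthonormal_set dot C.

Lemma oprojP : [/\ bounded_op (oproj C), forall x, closure (lin_span C) (oproj C x)
    & forall x, perp C (x - oproj C x)].
Proof. by have [P PP] := projection_exists oC; exact: (@xgetI _ 0 (is_oproj C) P PP). Qed.

Lemma bounded_oproj : bounded_op (oproj C). Proof. by case: oprojP. Qed.
Lemma oproj_closure x : closure (lin_span C) (oproj C x). Proof. by case: oprojP. Qed.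
Lemma sub_oproj_perp x : perp C (x - oproj C x). Proof. by case: oprojP. Qed.

Lemma oproj_id x : closure (lin_span C) x -> oproj C x = x.
Proof.
move=> Cx; apply/eqP; rewrite eq_sym -subr_eq0; apply/eqP.
apply: perp_closure_eq0 (sub_oproj_perp _).
exact: (subspaceB (closure_lin_span_subspace C) Cx (@oproj_closure x)).
Qed.

Lemma oproj_basis c : C c -> oproj C c = c.
Proof. by move=> Cc; apply/oproj_id/sub_closure_lin_span. Qed.

Lemma oproj_perp x : perp C x -> oproj C x = 0.
Proof.
move=> px; apply: perp_closure_eq0 (@oproj_closure x) _.
by have := subspaceB (perp_subspace C) px (sub_oproj_perp x); rewrite subKr.
Qed.

Lemma nrm_oproj_sqr x : nrm x ^+ 2 = nrm (x - oproj C x) ^+ 2 + nrm (oproj C x) ^+ 2.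
Proof.
rewrite -(pythagoras Hdot) ?subrK //.
have := sub_oproj_perp x; rewrite -perp_closure_span; apply; exact: (@oproj_closure x).
Qed.

Lemma nrm_sub_oproj x : nrm (x - oproj C x) <= nrm x.
Proof.
by apply: le_of_sqr_le; [exact: nrm_ge0|rewrite (nrm_oproj_sqr x) lerDl sqr_ge0].
Qed.

Lemma oproj_best x y : closure (lin_span C) y -> nrm (x - oproj C x) <= nrm (x - y).
Proof.
move=> Cy.
have -> : x - oproj C x = (x - y) - oproj C (x - y).
  by rewrite (linB (bounded_linear bounded_oproj)) (oproj_id Cy) opprB subrKA.
exact: nrm_sub_oproj.
Qed.

End Proj.
End Sums.

(** * Orthonormal bases and dimension *)

Arguments oproj_closure {R H dot} Hdot {C} oC x : rename.
Arguments sub_oproj_perp {R H dot} Hdot {C} oC x : rename.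

Section Dim.
Context {R : realType} {H : completeNormedModType R[i]}.
Variable dot : {dot H for Num.conj}.
Hypothesis Hdot : norm_from_dot dot.
Implicit Types (V B C D E : set H) (x y : H).

Definition normalize x : H := (nrm x)^-1%:C *: x.

Lemma nrm_normalize x : x != 0 -> nrm (normalize x) = 1.
Proof.
by move=> x0; rewrite nrmZ nrmR ger0_norm ?invr_ge0 ?nrm_ge0 // mulVf // nrm_eq0.
Qed.

Lemma normalizeK x : (nrm x)%:C *: normalize x = x.
Proof.
have [->|x0] := eqVneq x 0; first by rewrite /normalize !scaler0.
by rewrite scalerA -rmorphM /= divff ?scale1r // nrm_eq0.
Qed.

Lemma orthonormal_setU1 B e : orthonormal_set dot B -> nrm e = 1 -> perp dot B e ->
  orthonormal_set dot (B `|` [set e]).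
Proof.
move=> oB /(unit_nrm Hdot) e1 pe x y [Bx|->] [By|->]; last by rewrite eqxx.
- exact: oB.
- rewrite (dot_eq0_sym (pe _ Bx)); case: eqVneq => // xe.
  by have := pe _ Bx; rewrite xe e1 => /eqP; rewrite oner_eq0.
- rewrite (pe _ By); case: eqVneq => // ey.
  by have := pe _ By; rewrite -ey e1 => /eqP; rewrite oner_eq0.
Qed.

Lemma perp_notin B e : nrm e = 1 -> perp dot B e -> ~ B e.
Proof.
by move=> /(unit_nrm Hdot) e1 pe /pe; rewrite e1 => /eqP; rewrite oner_eq0.
Qed.

(** A maximal orthonormal subset of [V] is a basis, since otherwise the
    normalized component of a vector of [V] orthogonal to it could be added. *)
Lemma basis_exists V : subspace_of_hilbert V -> closure V = V ->
  exists B, orthonormal_basis dot V B.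
Proof.
move=> sV cV; pose P B := orthonormal_set dot B /\ B `<=` V.
have [F FP Ftot|B [[oB BV] Bmax]] := @Zorn_bigcup _ P.
  split=> [x y [X FX Xx] [Y FY Yy]|x [X FX Xx]]; last exact: (FP _ FX).2.
  have [XY|YX] := Ftot _ _ FX FY; first by apply: (FP _ FY).1 => //; exact: XY.
  by apply: (FP _ FX).1 => //; exact: YX.
exists B; split=> //; have BsV : closure (lin_span B) `<=` V.
  exact: closure_lin_span_min.
apply/seteqP; split=> // x Vx.
pose u := x - oproj dot B x.
have pu : perp dot B u by exact: sub_oproj_perp.
have [u0|u0] := eqVneq u 0.
  by rewrite (_ : x = oproj dot B x); [exact: oproj_closure|apply/eqP; rewrite -subr_eq0; exact/eqP].
have Vu : V u by apply: (subspaceB sV Vx); apply: BsV; exact: oproj_closure.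
have e1 := nrm_normalize u0.
have pe : perp dot B (normalize u) by exact: (subspaceZ (perp_subspace _ _)).
exfalso; apply: (Bmax (B `|` [set normalize u])).
  split; first by left.
  by move=> /(_ (normalize u) (or_intror erefl)); exact: perp_notin.
split; first exact: orthonormal_setU1.
by move=> y [/BV|->] //; exact: subspaceZ.
Qed.

Lemma hdimP V : subspace_of_hilbert V -> closure V = V ->
  orthonormal_basis dot V (hdim dot V).
Proof.
by move=> sV cV; have [B BP] := basis_exists sV cV; exact: (@xgetI _ set0 _ B BP).
Qed.

(** Gram-Schmidt, one vector of [D] at a time. *)
Lemma finite_span_basis D : finite_set D ->
  exists E, [/\ finite_set E, orthonormal_set dot E & D `<=` closure (lin_span E)].
Proof.
move=> /finite_seqP[s ->]; elim: s => [|d s [E [Efin oE sE]]].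
  by exists set0; split=> // x y [].
pose u := d - oproj dot E d.
have dE : d = oproj dot E d + u by rewrite addrC subrK.
have [u0|u0] := eqVneq u 0.
  exists E; split=> // x /=; rewrite inE => /orP[/eqP ->|/sE //].
  by rewrite dE u0 addr0; exact: oproj_closure.
have sub : closure (lin_span E) `<=` closure (lin_span (E `|` [set normalize u])).
  by apply: closureS; apply: lin_spanS; left.
exists (E `|` [set normalize u]); split.
- by rewrite finite_setU.
- apply: orthonormal_setU1 => //; first exact: nrm_normalize.
  exact: (subspaceZ (perp_subspace _ _) _ (sub_oproj_perp Hdot oE d)).
- move=> x /=; rewrite inE => /orP[/eqP ->|/sE /sub //].
  rewrite dE; apply: (subspaceD (closure_lin_span_subspace _)).
    by apply: sub; exact: oproj_closure.
  rewrite -[X in closure _ X](normalizeK u); apply: (subspaceZ (closure_lin_span_subspace _)).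
  exact: (sub_closure_lin_span (or_intror erefl)).
Qed.

Lemma finite_of_sum_le (A : set H) (g : H -> R) (d M : R) : 0 < d ->
  (forall x, A x -> d <= g x) ->
  (forall s : {fset H}, [set` s] `<=` A -> \sum_(x <- s) g x <= M) -> finite_set A.
Proof.
move=> d0 dg gM; apply: contrapT => Ainf.
have [s sA sn] := infinite_set_fset (Num.truncn (M / d)).+1 Ainf.
have le : (#|` s|)%:R * d <= M.
  apply: le_trans (gM s sA).
  rewrite mulr_natl -iter_addr_0 -count_predT -big_const_seq.
  by rewrite big_seq [leRHS]big_seq; apply: ler_sum => x xs; apply/dg/sA.
move: le; rewrite -ler_pdivlMr //; apply/negP; rewrite -ltNge.
apply: lt_le_trans (truncnS_gt _) _; by rewrite ler_nat.
Qed.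

(** By Bessel's inequality only finitely many [b] satisfy
    [1/(n+1) <= |dot d b|^2]. *)
Lemma countable_nonorthogonal B d : orthonormal_set dot B ->
  countable [set b | B b /\ dot b d != 0].
Proof.
move=> oB.
rewrite (_ : [set b | _] = \bigcup_n [set b | B b /\ n.+1%:R^-1 <= nrm (dot d b) ^+ 2]).
  apply: bigcup_countable => // n _; apply: finite_set_countable.
  apply: (@finite_of_sum_le _ (fun b => nrm (dot d b) ^+ 2) n.+1%:R^-1 (nrm d ^+ 2)).
  - by rewrite invr_gt0.
  - by move=> x [].
  - by move=> s sB; apply: (bessel Hdot d oB (fset_uniq s)) => b /sB[].
apply/seteqP; split=> [b [Bb bd]|b [n _ [Bb bd]]]; last first.
  split=> //; apply/eqP => /dot_eq0_sym db; move: bd; apply/negP.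
  by rewrite -ltNge db nrm0 expr0n invr_gt0.
have g0 : 0 < nrm (dot d b) ^+ 2.
  rewrite exprn_gt0 // nrm_gt0; apply: contra_neq bd; exact: dot_eq0_sym.
exists (Num.truncn (nrm (dot d b) ^+ 2)^-1) => //; split=> //.
by rewrite invf_ple ?posrE // ltW // truncnS_gt.
Qed.

Lemma nonperp_card_le B D : infinite_set D -> orthonormal_set dot B ->
  [set b | B b /\ ~ perp dot D b] #<= D.
Proof.
move=> Dinf oB.
apply: (@card_le_trans _ _ _ (\bigcup_(d in D) [set b | B b /\ dot b d != 0])); last first.
  apply: infinite_bigcup_card_le => // d _; exact: countable_nonorthogonal.
apply: subset_card_le => b [Bb /existsNP[d /not_implyP[Dd /eqP bd]]].
by exists d.
Qed.

Lemma oproj_fsum E (s : seq H) x : E = [set` s] -> uniq s -> orthonormal_set dot E ->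
  oproj dot E x = \sum_(e <- s) dot x e *: e.
Proof.
move=> Es us oE; have lP := bounded_linear (bounded_oproj Hdot oE).
set y := \sum_(e <- s) _.
have Ey : closure (lin_span E) y.
  apply: (subspace_sum (closure_lin_span_subspace _)) => e es.
  apply: (subspaceZ (closure_lin_span_subspace _)).
  by apply: sub_closure_lin_span; rewrite Es.
apply/eqP; rewrite -subr_eq0 -(oproj_id Hdot oE Ey) -(linB lP); apply/eqP.
apply: oproj_perp => // e; rewrite Es /= => es.
have Ee : E e by rewrite Es.
rewrite dotBl /y dot_suml (bigD1_seq e) //= dotZl (oE e e) // eqxx mulr1.
rewrite big_seq_cond big1 ?addr0 ?subrr // => c /andP[cs ce].
by rewrite dotZl (oE c e) // ?(negPf ce) ?mulr0 // Es.
Qed.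

(** The sum of the [|P b|^2] over [b] in [B], with [P] the projection onto the
    span of [E], is at most the number of elements of [E]: exchange the two
    sums and apply Bessel's inequality to each element of [E]. *)
Lemma finite_large_oproj B E (e : R) : finite_set E -> orthonormal_set dot E ->
  orthonormal_set dot B -> 0 < e ->
  finite_set [set b | B b /\ e <= nrm (oproj dot E b)].
Proof.
move=> Efin oE oB e0; pose s := fset_set E.
have Es : E = [set` s] by rewrite fset_setK.
apply: (@finite_of_sum_le _ (fun b => nrm (oproj dot E b) ^+ 2) (e ^+ 2) (\sum_(x <- s) 1)).
- by rewrite exprn_gt0.
- by move=> b [_ eb]; rewrite ler_sqr ?nnegrE ?nrm_ge0 // ltW.
move=> t tB; rewrite (eq_bigr (fun b => \sum_(x <- s) nrm (dot x b) ^+ 2)); last first.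
  move=> b _; rewrite (oproj_fsum b Es (fset_uniq s) oE).
  have uE := orthogonal_onZ (dot b) (orthonormal_on oE).
  rewrite (nrm_sum_sqr Hdot uE (fset_uniq s)); last by move=> c cs; rewrite Es.
  apply: eq_big_seq => c cs; rewrite nrmZ (orthonormal_nrm Hdot oE) ?mulr1.
    by rewrite dot_conj nrm_conj.
  by rewrite Es.
rewrite exchange_big /= big_seq [leRHS]big_seq; apply: ler_sum => x xs.
have x1 : nrm x = 1 by apply: (orthonormal_nrm Hdot oE); rewrite Es.
rewrite -[leRHS](expr1n _ 2) -x1.
by apply: (bessel Hdot x oB (fset_uniq t)) => b /tB[].
Qed.

(** All but fewer than [a] vectors of [B] are nearly orthogonal to [D].  If [D]
    is infinite, they are even orthogonal to it, because each [d] excludes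
    only countably many; if [D] is finite, then so is the exceptional set. *)
Lemma far_from_perp_card_lt T (a : set T) B D (e : R) : infinite_set a ->
  card_lt D a -> orthonormal_set dot B -> 0 < e ->
  card_lt [set b | B b /\ ~ exists2 b', perp dot D b' & nrm (b - b') <= e] a.
Proof.
move=> ainf Da oB e0; have [Dfin|Dinf] := pselect (finite_set D).
  apply: finite_card_lt => //.
  have [E [Efin oE DE]] := finite_span_basis Dfin.
  apply: sub_finite_set (finite_large_oproj Efin oE oB e0) => b [Bb nb].
  split=> //; rewrite leNgt; apply/negP => be; apply: nb.
  exists (b - oproj dot E b); last by rewrite opprB addrC subrK ltW.
  by move=> d /DE Dd; have := sub_oproj_perp Hdot oE b; rewrite -(perp_closure_span Hdot); apply.
apply: card_le_lt_trans Da; apply: card_le_trans (nonperp_card_le Dinf oB).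
apply: subset_card_le => b [Bb nb]; split=> // pb; apply: nb.
by exists b => //; rewrite subrr nrm0 ltW.
Qed.

(** A unit vector within [1/2] of the span of [D] cannot also be within [1/4]
    of its orthogonal complement, so every vector of [B] is exceptional in
    [far_from_perp_card_lt]. *)
Lemma card_lt_of_approx T (a : set T) B D : infinite_set a ->
  card_lt D a -> orthonormal_set dot B ->
  (forall b, B b -> exists2 y, lin_span D y & nrm (b - y) <= 2^-1) ->
  card_lt B a.
Proof.
move=> ainf Da oB app; have q0 : (0 : R) < 4^-1 by rewrite invr_gt0.
apply: card_le_lt_trans (far_from_perp_card_lt ainf Da oB q0).
apply: subset_card_le => b Bb; split=> // -[b' pb' bb'].
have [y Dy yb] := app b Bb.
have b1 := orthonormal_nrm Hdot oB Bb.
have E1 : dot b b = dot (b - y) b' + dot b (b - b').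
  by rewrite dotBl dotBr (dot_eq0_sym (perp_span Hdot pb' Dy)) subr0 addrC subrK.
have : nrm (dot b b) <= nrm (b - y) * nrm b' + nrm b * nrm (b - b').
  by rewrite E1; apply: le_trans (nrmD _ _) _; apply: lerD; exact: cauchy_schwarz.
rewrite (dotxx Hdot) nrmR b1 expr1n normr1 mul1r.
have := le_nrm_dist b' b; rewrite b1 nrmBC => b'1.
have : nrm (b - y) * nrm b' <= 2^-1 * nrm b' by rewrite ler_wpM2r ?nrm_ge0.
move: bb' b'1; lra.
Qed.

Lemma card_le_of_dense T (a : set T) B D : infinite_set a ->
  D #<= a -> orthonormal_set dot B -> B `<=` closure (lin_span D) -> B #<= a.
Proof.
move=> ainf Da oB BD; have [Dfin|Dinf] := pselect (finite_set D).
  apply/card_ltW/(card_lt_of_approx ainf (finite_card_lt Dfin ainf) oB) => b Bb.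
  have /closure_nrmP/(_ 2^-1)[|y Dy yb] := BD _ Bb; first by rewrite invr_gt0.
  by exists y => //; exact: ltW.
apply: card_le_trans Da; apply: card_le_trans (nonperp_card_le Dinf oB).
apply: subset_card_le => b Bb; split=> // pb.
have := orthonormal_nrm Hdot oB Bb.
rewrite (perp_closure_eq0 Hdot (BD _ Bb) pb) nrm0 => /eqP.
by rewrite eq_sym oner_eq0.
Qed.

End Dim.

(** * Operators that are compact relative to a cardinal *)

Section Small.
Context {R : realType} {H : completeNormedModType R[i]}.
Variable dot : {dot H for Num.conj}.
Hypothesis Hdot : norm_from_dot dot.
Implicit Types (V B C D E : set H) (x y : H) (A : H -> H).

Section OpNorm.

Lemma nrm_le_opnorm A x : bounded_op A -> nrm (A x) <= opnorm A * nrm x.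
Proof.
move=> /bounded_opP[lA [M M0 AM]].
have [->|x0] := eqVneq x 0; first by rewrite (lin0 lA) !nrm0 mulr0.
rewrite -{1}(normalizeK x) (linZ lA) nrmZ nrmR ger0_norm ?nrm_ge0 // mulrC.
apply: ler_wpM2r; first exact: nrm_ge0.
apply: ub_le_sup; last first.
  exists (normalize x) => //=.
  by rewrite normE lecR nrm_normalize.
exists M => _ [u /= + <-]; rewrite normE lecR => u1.
by apply: le_trans (AM u) _; rewrite ler_piMr // ltW.
Qed.

Lemma opnorm_le A (M : R) : 0 <= M -> (forall x, nrm (A x) <= M * nrm x) -> opnorm A <= M.
Proof.
move=> M0 AM; apply: ge_sup.
  by exists (nrm (A 0)); exists 0 => //=; rewrite normr0.
move=> _ [u /= + <-]; rewrite normE lecR => u1.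
by apply: le_trans (AM u) _; rewrite ler_piMr.
Qed.

End OpNorm.

Section Ideal.
Context {T : Type}.
Variable a : set T.
Hypothesis ainf : infinite_set a.

(** For the first infinite cardinal, this is the usual compactness.  Replacing a
    bound on the dimension of the range by approximation is what makes the
    class closed in norm, whatever the cofinality of [a]. *)
Definition card_compact : set (H -> H) := [set A | bounded_op A /\
  forall e : R, 0 < e -> exists2 D : set H, card_lt D a &
    forall x, exists2 y, lin_span D y & nrm (A x - y) <= e * nrm x].

Lemma card_compact_add (A B : H -> H) : card_compact A -> card_compact B -> card_compact (A + B).
Proof.
move=> [bA sA] [bB sB]; split; first exact: bounded_add.
move=> e e0; have e20 : 0 < e / 2 by rewrite divr_gt0.
have [D Da DA] := sA _ e20; have [D' Da' DB] := sB _ e20.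
exists (D `|` D'); first exact: card_lt_setU.
move=> x; have [y Dy xy] := DA x; have [y' Dy' xy'] := DB x.
exists (y + y').
  apply: (subspaceD (lin_span_subspace _)).
    by apply: lin_spanS Dy; left.
  by apply: lin_spanS Dy'; right.
rewrite (_ : _ - _ = (A x - y) + (B x - y')); last by rewrite opprD addrACA.
by apply: le_trans (nrmD _ _) _; rewrite (splitr e) mulrDl lerD.
Qed.

Lemma card_compact_compl S A : bounded_op S -> card_compact A -> card_compact (S \o A).
Proof.
move=> bS [bA sA]; split; first exact: bounded_comp.
have /bounded_opP[lS [M M0 SM]] := bS.
move=> e e0; have [|D Da DA] := sA (e / M); first by rewrite divr_gt0.
exists (S @` D); first by apply: card_le_lt_trans Da; exact: card_image_le.
move=> x; have [y Dy xy] := DA x; exists (S y); first exact: lin_span_image.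
rewrite -(linB lS); apply: le_trans (SM _) _.
by rewrite mulrC -ler_pdivlMr // mulrAC.
Qed.

Lemma card_compact_compr A S : bounded_op S -> card_compact A -> card_compact (A \o S).
Proof.
move=> bS [bA sA]; split; first exact: bounded_comp.
have /bounded_opP[lS [M M0 SM]] := bS.
move=> e e0; have [|D Da DA] := sA (e / M); first by rewrite divr_gt0.
exists D => // x; have [y Dy xy] := DA (S x); exists y => //.
apply: le_trans xy _; rewrite mulrAC ler_pdivrMr // -mulrA.
by rewrite ler_pM2l // mulrC.
Qed.

Lemma card_compact_closed : opnorm_closed card_compact.
Proof.
move=> A bA app; split=> // e e0; have e20 : 0 < e / 2 by rewrite divr_gt0.
have [B [bB sB] AB] := app _ e20.
have [D Da DB] := sB _ e20; exists D => // x; have [y Dy xy] := DB x.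
exists y => //; apply: le_trans (nrm_dist (B x) _ _) _.
rewrite (splitr e) mulrDl; apply: lerD => //.
have bAB : bounded_op (A - B).
  by rewrite -scaleN1r; apply: bounded_add => //; exact: bounded_scale.
apply: le_trans (nrm_le_opnorm x bAB) _.
by apply: ler_wpM2r; [exact: nrm_ge0|exact: ltW].
Qed.

Lemma card_compact_closed_ideal : closed_ideal card_compact.
Proof.
split; last exact: card_compact_closed.
split.
- by move=> A [].
- split; first exact: bounded0.
  move=> e e0; exists set0; first by apply: finite_card_lt => //; exact: finite_set0.
  move=> x; exists 0; first exact: (subspace0 (lin_span_subspace _)).
  by rewrite subr0 nrm0 mulr_ge0 ?nrm_ge0 // ltW.
- exact: card_compact_add.
- move=> c A sA; apply: (@card_compact_compl (c *: idfun)) => //.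
  by apply: bounded_scale; exact: bounded_id.
- by move=> S A bS sA; split; [exact: card_compact_compl|exact: card_compact_compr].
Qed.

End Ideal.

(** The value at [y] of the adjoint of [A] (Riesz): if [u] is orthogonal to the
    kernel of the functional, then [x] differs from a multiple of [u] by an
    element of the kernel. *)
Lemma adjoint_vector A y : bounded_op A -> exists z, forall x, dot (A x) y = dot x z.
Proof.
move=> bA; have lA := bounded_linear bA.
pose V : set H := [set x | dot (A x) y = 0].
have [f0|/existsNP[x0 /eqP t0]] := pselect (forall x, dot (A x) y = 0).
  by exists 0 => x; rewrite f0 dot0r.
have sV : subspace_of_hilbert V.
  split=> [|c u v]; first by rewrite /V /= (lin0 lA) dot0l.
  by rewrite /V /= lA dotDl dotZl => -> ->; rewrite mulr0 addr0.
have cV : closure V = V.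
  apply/seteqP; split; last exact: subset_closure.
  move=> x Vx; have : closure (perp dot [set y]) (A x).
    apply: (bounded_closure bA) Vx => v Vv; apply: subset_closure => _ ->.
    exact: Vv.
  by rewrite perp_closed // => /(_ y erefl).
have [E [oE EV]] := basis_exists Hdot sV cV.
pose u := x0 - oproj dot E x0.
have uV v : V v -> dot v u = 0.
  rewrite -EV => Ev; apply: dot_eq0_sym.
  by have := sub_oproj_perp Hdot oE x0; rewrite -(perp_closure_span Hdot); apply.
have tu : dot (A u) y = dot (A x0) y.
  rewrite /u (linB lA) dotBl (_ : dot (A (oproj _ _ _)) y = 0) ?subr0 //.
  suff : V (oproj dot E x0) by [].
  by rewrite -EV; exact: oproj_closure.
set t := dot (A x0) y in t0 tu.
have u0 : dot u u != 0.
  rewrite (dotxx Hdot) fmorph_eq0 sqrf_eq0 nrm_eq0; apply: contra_neq t0 => u0.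
  by rewrite -tu u0 (lin0 lA) dot0l.
(* The factor is conjugated because [dot] is antilinear on the right. *)
exists (Num.conj (t / dot u u) *: u) => x.
have /uV : V (x - (dot (A x) y / t) *: u).
  by rewrite /V /= (linB lA) (linZ lA) dotBl dotZl tu divfK // subrr.
move/eqP; rewrite dotBl dotZl subr_eq0 => /eqP xu.
by rewrite dotZr conjCK xu; field; rewrite t0 u0.
Qed.

Definition bounded_below_set A (e : R) X := [/\ orthonormal_set dot X, orthogonal_on dot X A
  & forall x, X x -> e <= nrm (A x)].

(** The dichotomy.  A vector [x1] orthogonal to [X] and to the adjoint images
    of [A @` X] can be added to [X] as soon as [|A x1| >= e * |x1|]; such a
    vector is obtained from some [x] with [A x] far from the span of the image
    of these fewer than [a] vectors, by removing its projection onto them. *)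
Lemma bounded_below_set_exists (a : set H) A :
  infinite_set a -> bounded_op A -> ~ card_compact a A ->
  exists e X, [/\ 0 < e, bounded_below_set A e X & a #<= X].
Proof.
move=> ainf bA nsA; have lA := bounded_linear bA.
have [e [e0 eP]] : exists e : R, 0 < e /\ forall D, card_lt D a ->
    exists x, forall y, lin_span D y -> e * nrm x < nrm (A x - y).
  apply: contrapT => /forallNP h; apply: nsA; split=> // e e0.
  apply: contrapT => nD; apply: (h e); split=> // D Da.
  apply: contrapT => nx; apply: nD; exists D => // x.
  apply: contrapT => ny; apply: nx; exists x => y Dy.
  by rewrite ltNge; apply/negP => xy; apply: ny; exists y.
have [F FP Ftot|X [[oX oAX Xe] Xmax]] := @Zorn_bigcup _ (bounded_below_set A e).
  split=> [x y [X FX Xx] [Y FY Yy]|x y [X FX Xx] [Y FY Yy]|x [X FX Xx]].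
  - have [XY|YX] := Ftot _ _ FX FY.
      by have [oF _ _] := FP _ FY; apply: oF => //; exact: XY.
    by have [oF _ _] := FP _ FX; apply: oF => //; exact: YX.
  - have [XY|YX] := Ftot _ _ FX FY.
      by have [_ oF _] := FP _ FY; apply: oF => //; exact: XY.
    by have [_ oF _] := FP _ FX; apply: oF => //; exact: YX.
  - by case: (FP _ FX) => _ _; apply.
exists e, X; split=> //; apply: card_ltNge => Xa.
have /choice[adj adjP] : forall y, exists z, forall x, dot (A x) (A y) = dot x z.
  by move=> y; exact: adjoint_vector.
pose S := X `|` adj @` X.
have Sa : card_lt S a.
  apply: card_lt_setU => //; apply: card_le_lt_trans Xa; exact: card_image_le.
have ASa : card_lt (A @` S) a by apply: card_le_lt_trans Sa; exact: card_image_le.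
have [x xP] := eP _ ASa.
have [E [oE ES]] := basis_exists Hdot (closure_lin_span_subspace S) (closure_closure _).
pose x1 := x - oproj dot E x.
have px1 : perp dot S x1.
  have := sub_oproj_perp Hdot oE x; rewrite -(perp_closure_span Hdot) ES.
  by rewrite (perp_closure_span Hdot).
(* The removed component is sent into the closed span of [A @` S]. *)
have Ax1 : e * nrm x <= nrm (A x1).
  apply/ler_addgt0Pl => d d0.
  have : closure (lin_span (A @` S)) (A (oproj dot E x)).
    apply: (bounded_closure_span bA (B := S)); first by move=> v Sv; exists v.
    by rewrite -ES; exact: oproj_closure.
  move=> /closure_nrmP/(_ _ d0)[y Dy Py]; apply: le_trans (ltW (xP y Dy)) _.
  apply: le_trans (nrm_dist (A (oproj dot E x)) _ _) _.
  by rewrite addrC -(linB lA); apply: lerD => //; exact: ltW.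
have x10 : x1 != 0.
  apply/eqP => x10; move: Ax1; rewrite x10 (lin0 lA) nrm0 pmulr_rle0 // => x0.
  have := xP 0 (subspace0 (lin_span_subspace _)).
  have /eqP : nrm x == 0 by rewrite eq_le x0 nrm_ge0.
  move=> /eqP; rewrite nrm_eq0 => /eqP ->; rewrite (lin0 lA) subr0 nrm0 mulr0.
  by rewrite ltxx.
pose u := normalize x1.
have pu : perp dot S u by exact: (subspaceZ (perp_subspace _ _)).
have u1 : nrm u = 1 by exact: nrm_normalize.
have puX : perp dot X u by move=> y Xy; apply: pu; left.
apply: (Xmax (X `|` [set u])).
  split; first by left.
  by move=> /(_ u (or_intror erefl)); exact: perp_notin.
have oA y : X y -> dot (A u) (A y) = 0.
  by move=> Xy; rewrite adjP; apply: pu; right; exists y.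
split; first exact: orthonormal_setU1.
  move=> b c [Xb|->] [Xc|->]; [exact: oAX|by move=> _; apply/dot_eq0_sym/oA|by move=> _; exact: oA|].
  by rewrite eqxx.
move=> b [/Xe //|->].
rewrite (linZ lA) nrmZ nrmR ger0_norm ?invr_ge0 ?nrm_ge0 //.
rewrite mulrC ler_pdivlMr ?nrm_gt0 //; apply: le_trans Ax1.
by rewrite ler_pM2l //; exact: nrm_sub_oproj.
Qed.

End Small.

(** * Operators bounded below on an orthonormal set *)

Section Classes.
Context {R : realType} {H : completeNormedModType R[i]}.
Variable dot : {dot H for Num.conj}.
Hypothesis Hdot : norm_from_dot dot.
Implicit Types (V B C D E : set H) (x y : H) (A : H -> H).

(** An injection between orthonormal sets extends to a partial isometry with a
    left inverse on the closed span. *)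
Lemma isometry_of_inj C X (f : H -> H) :
  orthonormal_set dot C -> orthonormal_set dot X -> (forall c, C c -> X (f c)) ->
  (forall c d, C c -> C d -> f c = f d -> c = d) ->
  exists S S' : H -> H, [/\ bounded_op S, bounded_op S', forall c, C c -> S c = f c,
    forall c, C c -> S' (f c) = c &
    (forall x, perp dot C x -> S x = 0) /\
    (forall x y, closure (lin_span C) x -> closure (lin_span C) y ->
      dot (S x) (S y) = dot x y)].
Proof.
move=> oC oX fX finj.
have ofC : orthogonal_on dot C f.
  move=> c d Cc Cd cd; rewrite oX ?(negPf _) //; [|exact: fX|exact: fX].
  by rewrite (_ : f c == f d = false) //; apply/negP => /eqP/finj cdE; rewrite cdE // eqxx in cd.
have f1 c : C c -> nrm (f c) <= 1 by move=> /fX/(orthonormal_nrm Hdot oX) ->.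
have [S [bS SC Sp _ Sd]] := diagonal_op Hdot oC ofC ltr01 f1.
have /choice[g gP] : forall y, exists c, (f @` C) y -> C c /\ f c = y.
  move=> y; have [[c Cc <-]|n] := pselect ((f @` C) y); first by exists c.
  by exists 0.
have ofX : orthonormal_set dot (f @` C).
  by apply: orthonormal_sub oX => _ [c /fX Xc <-].
have ogC : orthogonal_on dot (f @` C) g.
  move=> y z /gP[Cy fy] /gP[Cz fz] yz; rewrite oC // (_ : g y == g z = false) //.
  by apply: contra_neqF yz => /eqP gyz; rewrite -fy gyz.
have g1 y : (f @` C) y -> nrm (g y) <= 1 by move=> /gP[/(orthonormal_nrm Hdot oC) ->].
have [S' [bS' SC' _ _ _]] := diagonal_op Hdot ofX ogC ltr01 g1.
exists S, S'; split=> //.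
  move=> c Cc; have fc : (f @` C) (f c) by exists c.
  by rewrite SC' //; have [Cg fg] := gP _ fc; apply: finj.
split=> // x y Cx Cy.
have [z zP] := adjoint_vector Hdot (S x) bS.
(* [z] is the value at [S x] of the adjoint of [S]; it agrees with [x] on [C]. *)
have zx : perp dot (closure (lin_span C)) (x - z).
  rewrite (perp_closure_span Hdot) => c Cc; rewrite dotBl.
  have := zP c; rewrite (SC _ Cc) => /(congr1 Num.conj).
  rewrite -!dot_conj => <-; rewrite Sd // (unit_nrm Hdot _).2 ?mulr1 ?subrr //.
  exact/(orthonormal_nrm Hdot oX)/fX.
have := zx _ Cy; rewrite dotBl => /eqP; rewrite subr_eq0 => /eqP ->.
by rewrite [RHS]dot_conj -zP -dot_conj.
Qed.

(** The normalized images of [X] form an orthonormal set [Y], and the diagonal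
    operator on [Y] with coefficients [1/|A x|], bounded by [1/e], inverts [A]. *)
Lemma bounded_below_inverse A e X : bounded_op A -> 0 < e -> bounded_below_set dot A e X ->
  exists T Y, [/\ bounded_op T, forall x, X x -> T (A x) = x, orthonormal_set dot Y,
     Y #= X /\ Y `<=` range A & forall y, closure (lin_span Y) y -> A (T y) = y].
Proof.
move=> bA e0 [oX oA Xe]; have lA := bounded_linear bA.
pose h x := normalize (A x).
have An0 x : X x -> A x != 0.
  by move=> /Xe Ae; rewrite -nrm_gt0; apply: lt_le_trans Ae.
have oh : orthogonal_on dot X h.
  by move=> x y Xx Xy xy; rewrite dotZl dotZr oA // !mulr0.
have h1 x : X x -> dot (h x) (h x) = 1.
  by move=> /An0 Ax; apply/(unit_nrm Hdot); exact: nrm_normalize.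
have hinj x y : X x -> X y -> h x = h y -> x = y.
  move=> Xx Xy hxy; apply/eqP; apply: contraT => xy.
  by have := oh x y Xx Xy xy; rewrite -hxy h1 // => /eqP; rewrite oner_eq0.
pose Y := h @` X.
have oY : orthonormal_set dot Y.
  move=> _ _ [x Xx <-] [y Xy <-]; case: eqVneq => [->|hxy]; first exact: h1.
  by apply: oh => //; apply: contra_neq hxy => ->.
have /choice[g gP] : forall y, exists x, Y y -> X x /\ h x = y.
  move=> y; have [[x Xx <-]|n] := pselect (Y y); first by exists x.
  by exists 0.
have gh x : X x -> g (h x) = x.
  move=> Xx; have Yh : Y (h x) by exists x.
  by have [Xg hg] := gP _ Yh; exact: hinj.
pose k y := (nrm (A (g y)))^-1%:C *: g y.
have ok : orthogonal_on dot Y k.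
  move=> y z Yy Yz yz; rewrite dotZl dotZr; have [Xy hy] := gP _ Yy; have [Xz hz] := gP _ Yz.
  rewrite (oX _ _ Xy Xz) (_ : g y == g z = false) ?mulr0 //.
  by apply: contra_neqF yz => /eqP gyz; rewrite -hy gyz.
have kb y : Y y -> nrm (k y) <= e^-1.
  move=> /gP[Xy _]; rewrite nrmZ nrmR (orthonormal_nrm Hdot oX Xy) mulr1.
  rewrite ger0_norm ?invr_ge0 ?nrm_ge0 // lef_pV2 ?posrE //; first exact: Xe.
  by rewrite nrm_gt0 An0.
have ei0 : 0 < e^-1 by rewrite invr_gt0.
have [T [bT TY _ _ _]] := diagonal_op Hdot oY ok ei0 kb.
have lT := bounded_linear bT.
exists T, Y; split=> //.
- move=> x Xx; have Yh : Y (h x) by exists x.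
  rewrite -(normalizeK (A x)) (linZ lT) TY // /k gh //.
  by rewrite scalerA -rmorphM /= divff ?scale1r // nrm_eq0 An0.
- split; first by apply: inj_card_eq => x y /set_mem Xx /set_mem Xy; exact: hinj.
  by move=> _ [x Xx <-]; exists ((nrm (A x))^-1%:C *: x) => //; rewrite (linZ lA).
- move=> y Yy; apply: (eq_on_closure_span (bounded_comp bA bT) bounded_id) Yy => z Yz /=.
  by rewrite TY // /k (linZ lA); exact: (gP _ Yz).2.
Qed.

(** If [B] were finite, it would be smaller than [Y] and yet approximate it. *)
Lemma orthonormal_card_le B Y : infinite_set Y -> orthonormal_set dot Y ->
  Y `<=` closure (lin_span B) -> Y #<= B.
Proof.
move=> Yinf oY YB; have [Bfin|Binf] := pselect (finite_set B); last first.
  exact: (card_le_of_dense Hdot Binf).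
have BY : card_lt B Y by exact: finite_card_lt.
have /card_ltP[_] : card_lt Y Y; last by have := card_lexx Y.
apply: (card_lt_of_approx Hdot Yinf BY oY) => y /YB/closure_nrmP/(_ 2^-1)[|b Bb yb].
  by rewrite invr_gt0.
by exists b => //; exact: ltW.
Qed.

Lemma iota_rP A : bounded_op A -> orthonormal_basis dot (closure (range A)) (iota_r dot A).
Proof.
move=> bA; apply: (hdimP Hdot); last exact: closure_closure.
exact/closure_subspace/range_subspace/bounded_linear.
Qed.

(** Otherwise the range of [A] contains the closed span of an orthonormal set
    [Y] with at least [a] elements, which has to be isomorphic to the closure
    of the range, of dimension [a]. *)
Lemma Jideal_sub_card_compact (a : set H) : infinite_set a -> Jideal dot a `<=` card_compact a.
Proof.
move=> ainf A [bA JA]; apply: contrapT => nsA.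
have [e [X [e0 gX aX]]] := bounded_below_set_exists Hdot ainf bA nsA.
have [T [Y [bT _ oY [YX YA] AT]]] := bounded_below_inverse bA e0 gX.
have aY : a #<= Y by rewrite (card_le_eqr YX).
have Yinf : infinite_set Y by move=> Yfin; apply: ainf; exact: card_le_finite aY Yfin.
have [oB BM] := iota_rP bA; set B := iota_r dot A in oB BM JA.
have YB : Y #<= B.
  by apply: orthonormal_card_le => //; rewrite BM => y /YA; exact: subset_closure.
case: JA => [/card_ltP[_]|[Ba iA]]; first by apply; exact: card_le_trans YB.
have BY : B #= Y.
  apply/card_eqPle; split=> //; apply: card_le_trans aY.
  by move/card_eqPle: Ba => -[].
have /card_set_bijP[f [fBY finj fsurj]] := BY.
have {}finj x y : B x -> B y -> f x = f y -> x = y.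
  by move=> Bx By; apply: finj; rewrite inE.
have [S [S' [bS bS' SB SB' [_ Sdot]]]] := isometry_of_inj oB oY fBY finj.
move: iA; rewrite /iota_b /frakb; case: asboolP => // nF _; apply: nF.
exists (closure (lin_span Y)); split.
- exact: closure_lin_span_subspace.
- by move=> y /AT <-; exists (T y).
rewrite -BM; exists S; split=> //.
  by move=> c x y _ _; rewrite (bounded_linear bS).
apply/seteqP; split=> [_ [x Bx <-]|y Yy].
  by apply: (bounded_closure_span bS) Bx => b Bb; rewrite SB //; exact: fBY.
exists (S' y).
  apply: (bounded_closure_span bS') Yy => z Yz.
  by have [b Bb <-] := fsurj _ Yz; rewrite SB'.
apply: (eq_on_closure_span (bounded_comp bS bS') bounded_id) Yy => z Yz /=.
by have [b Bb <-] := fsurj _ Yz; rewrite SB' // SB.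
Qed.

End Classes.

(** * The gliding hump *)

Section Hump.
Context {R : realType} {H : completeNormedModType R[i]}.
Variable dot : {dot H for Num.conj}.
Hypothesis Hdot : norm_from_dot dot.
Implicit Types (V B C D E : set H) (x y : H) (A : H -> H).

Let h : R := 2^-1.

Let h_gt0 n : 0 < h ^+ n. Proof. by rewrite exprn_gt0 // invr_gt0. Qed.

Let h_small (e : R) : 0 < e -> exists N, h ^+ N < e.
Proof.
move=> e0; exists (Num.truncn e^-1); rewrite exprVn invf_plt ?posrE ?exprn_gt0 //.
apply: lt_le_trans (truncnS_gt _) _.
by rewrite -natrX ler_nat ltn_expl.
Qed.

(** The sum of the [2^-n *: u n].  Repetitions among the [u n] only increase
    the inner products, so no choice of distinct vectors is needed. *)
Lemma geometric_sum M B (u : nat -> H) : subspace_of_hilbert M -> closure M = M ->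
  orthonormal_set dot B -> B `<=` M -> (forall n, B (u n)) ->
  exists2 z, M z & forall n, h ^+ n <= complex.Re (dot z (u n)).
Proof.
move=> sM cM oB BM uB.
have u1 n : nrm (u n) = 1 by exact: (orthonormal_nrm Hdot oB).
pose z n := \sum_(k < n) (h ^+ k)%:C *: u k.
have zS n : z n.+1 = z n + (h ^+ n)%:C *: u n by rewrite /z big_ord_recr.
have z_dist m n : nrm (z (m + n)%N - z m) <= 2 * (h ^+ m - h ^+ (m + n)).
  elim: n => [|n IH]; first by rewrite addn0 !subrr nrm0 mulr0.
  rewrite addnS zS addrAC; apply: le_trans (nrmD _ _) _.
  rewrite nrmZ nrmR u1 mulr1 ger0_norm ?(ltW (h_gt0 _)) //.
  by move: IH; rewrite [h ^+ (m + n).+1]exprS /h; set p := 2^-1 ^+ (m + n); lra.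
have z_near N n : (N <= n)%N -> nrm (z n - z N) <= 2 * h ^+ N.
  move=> /subnKC <-; apply: le_trans (z_dist _ _) _.
  by have := h_gt0 (N + (n - N)); lra.
have [|w wP] := @complete_nrm _ _ z.
  move=> e e0; have [|N hN] := h_small (e := e / 4); first by rewrite divr_gt0.
  exists N => n m Nn Nm; apply: le_lt_trans (nrm_dist (z N) _ _) _.
  have := z_near _ _ Nn; have := z_near _ _ Nm; rewrite (nrmBC (z N)).
  by move: hN; lra.
exists w.
  rewrite -cM; apply/closure_nrmP => e /wP[N NP]; exists (z N).
    apply: (big_ind M) => [||k _]; [exact: subspace0|exact: subspaceD|].
    by apply: subspaceZ => //; exact: BM.
  by rewrite nrmBC; exact: NP.
move=> n; apply/ler_addgt0Pl => e e0.
have [N NP] := wP _ e0.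
have Re_z m : h ^+ n *+ (n < m)%N <= complex.Re (dot (z m) (u n)).
  elim: m => [|m IH]; first by rewrite ltn0 /z big_ord0 dot0l mulr0n.
  have Re_u : complex.Re (dot ((h ^+ m)%:C *: u m) (u n)) = h ^+ m *+ (u m == u n).
    rewrite dotZl oB //; case: eqP => _; first by rewrite mulr1 mulr1n.
    by rewrite mulr0 mulr0n.
  have g0 : 0 <= h ^+ m *+ (u m == u n) by rewrite mulrn_wge0 // ltW.
  rewrite zS dotDl raddfD /= Re_u ltnS leq_eqVlt.
  have [nm|mn] := eqVneq n m; last by apply: (le_trans IH); rewrite lerDl.
  subst m; rewrite eqxx mulr1n /= -[leLHS]add0r; apply: lerD => //.
  by apply: le_trans IH; rewrite mulrn_wge0 // ltW.
have le_e : nrm (z (maxn N n.+1) - w) <= e by apply/ltW/NP; exact: leq_maxl.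
have := nrm_dot_approx Hdot (u n) (ltW e0) le_e; rewrite u1 mulr1 => zw.
have := Re_z (maxn N n.+1); rewrite leq_max leqnn orbT mulr1n => /le_trans; apply.
have := Re_le_nrm (dot (z (maxn N n.+1)) (u n) - dot w (u n)).
by rewrite raddfB /=; move: zw; lra.
Qed.


(** If [U] maps the closure of the range isometrically into the range, then
    almost all images of basis vectors are nearly orthogonal to the [n]-th
    approximating set [D n]; choose one, [U (u n)], for each [n].  The vector
    [A x = U z], for the sum [z] of the [2^-n *: u n], has inner product at
    least [2^-n] with [U (u n)], while nearness of [A x] to the span of [D n]
    bounds it by a multiple of [4^-n]. *)
Lemma card_compact_sub_Jideal (a : set H) : infinite_set a -> card_compact a `<=` Jideal dot a.
Proof.
move=> ainf A [bA sA]; have lA := bounded_linear bA; split=> //.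
have [oB BM] := iota_rP Hdot bA; set B := iota_r dot A in oB BM *.
have /choice[D DP] : forall n, exists D : set H, card_lt D a /\
    forall x, exists2 y, lin_span D y & nrm (A x - y) <= h ^+ n * h ^+ n * nrm x.
  by move=> n; have [|D Da DA] := sA (h ^+ n * h ^+ n); [exact: mulr_gt0|exists D].
have Ba : B #<= a.
  apply: (card_le_of_dense Hdot ainf (D := \bigcup_n D n)) => //.
    by apply: countable_bigcup_card_le => // n; exact/card_ltW/(DP n).1.
  have BcM : B `<=` closure (range A) by rewrite -BM; exact: sub_closure_lin_span.
  move=> b /BcM; rewrite -(closure_closure (lin_span _)); apply: closureS.
  move=> _ [x _ <-]; apply/closure_nrmP => e e0.
  have k0 : 0 < nrm x + 1 by have := nrm_ge0 x; lra.
  have [|N hN] := h_small (e := e / (nrm x + 1)); first by rewrite divr_gt0.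
  have [y Dy xy] := (DP N).2 x; exists y.
    by apply: lin_spanS Dy; exact: bigcup_sup.
  apply: le_lt_trans xy _.
  have hN1 : h ^+ N <= 1 by rewrite exprn_ile1 // /h; lra.
  apply: (@le_lt_trans _ _ (h ^+ N * (nrm x + 1))); last by rewrite -ltr_pdivlMr.
  rewrite -mulrA ler_pM2l //.
  apply: (@le_trans _ _ (nrm x)); last by rewrite lerDl.
  by rewrite ler_piMl ?nrm_ge0.
have [Balt|nBa] := pselect (card_lt B a); first by left.
right; have Baeq : B #= a.
  by apply/negPn/negP => n; apply: nBa; rewrite /card_lt Ba.
split=> //; rewrite /iota_b /frakb; case: asboolP => // -[F [sF FA [U [linU Udot UF]]]].
exfalso; pose M := closure (range A).
have sM : subspace_of_hilbert M by apply: closure_subspace; exact: range_subspace.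
have cM : closure M = M by exact: closure_closure.
have BM' : B `<=` M by rewrite /M -BM; exact: sub_closure_lin_span.
have UB b c : B b -> B c -> dot (U b) (U c) = (b == c)%:R.
  by move=> Bb Bc; rewrite (Udot _ _ (BM' _ Bb) (BM' _ Bc)) oB.
have Uinj b c : B b -> B c -> U b = U c -> b = c.
  move=> Bb Bc Ubc; apply/eqP; apply: contraT => bc; have := UB _ _ Bb Bc.
  by rewrite Ubc UB // eqxx (negPf bc) => /eqP; rewrite oner_eq0.
have oUB : orthonormal_set dot (U @` B).
  move=> _ _ [b Bb <-] [c Bc <-]; rewrite UB //; congr (_%:R).
  by case: eqVneq => [->|bc]; [rewrite eqxx|case: eqP => // /(Uinj _ _ Bb Bc)/eqP; rewrite (negPf bc)].
have UBa : ~ card_lt (U @` B) a.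
  move=> /card_ltP[_]; apply; rewrite -(card_le_eql Baeq).
  suff /card_eqPle[_] : U @` B #= B by [].
  by apply: inj_card_eq => b c /set_mem Bb /set_mem Bc; exact: Uinj.
have /choice[u uP] : forall n, exists b, B b /\
    exists2 b', perp dot (D n) b' & nrm (U b - b') <= h ^+ n * h ^+ n.
  move=> n; apply: contrapT => /forallNP nb; apply: UBa.
  have hh : 0 < h ^+ n * h ^+ n by exact: mulr_gt0.
  apply: card_le_lt_trans (far_from_perp_card_lt Hdot ainf (DP n).1 oUB hh).
  apply: subset_card_le => _ [b Bb <-]; split; first by exists b.
  by move=> nb'; apply: (nb b).
have [z Mz zP] := geometric_sum sM cM oB BM' (fun n => (uP n).1).
have [x _ Ax] : range A (U z) by apply: FA; rewrite -UF; exists z.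
(* Both error terms carry a factor [4^-n], against the lower bound [2^-n]. *)
have key n : 1 <= h ^+ n * (2 * nrm x + nrm (A x)).
  have [Bu [b' pb' ub']] := uP n; have [y Dy xy] := (DP n).2 x.
  have Un : nrm (U (u n)) = 1 by apply: (orthonormal_nrm Hdot oUB); exists (u n).
  have hn1 : h ^+ n <= 1 by rewrite exprn_ile1 // /h; lra.
  have hh1 : h ^+ n * h ^+ n <= 1 by rewrite mulr_ile1 // ltW.
  have b'2 : nrm b' <= 2 by have := le_nrm_dist b' (U (u n)); rewrite Un nrmBC; lra.
  have E : dot (A x) (U (u n)) = dot (A x - y) b' + dot (A x) (U (u n) - b').
    by rewrite dotBl dotBr (dot_eq0_sym (perp_span Hdot pb' Dy)) subr0 addrC subrK.
  have := zP n; rewrite -(Udot _ _ Mz (BM' _ Bu)) -Ax E => zn.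
  have := le_trans zn (Re_le_nrm _) => {}zn.
  have := le_trans zn (nrmD _ _) => {}zn.
  have c1 := cauchy_schwarz Hdot (A x - y) b'.
  have c2 := cauchy_schwarz Hdot (A x) (U (u n) - b').
  have c3 : nrm (A x - y) * nrm b' <= h ^+ n * h ^+ n * nrm x * 2.
    by apply: ler_pM => //; exact: nrm_ge0.
  have c4 : nrm (A x) * nrm (U (u n) - b') <= nrm (A x) * (h ^+ n * h ^+ n).
    by rewrite ler_wpM2l // nrm_ge0.
  have : h ^+ n <= h ^+ n * (h ^+ n * (2 * nrm x + nrm (A x))).
    by move: zn c1 c2 c3 c4; set p := h ^+ n; nra.
  by rewrite -[leLHS]mulr1 ler_pM2l.
pose k := 2 * nrm x + nrm (A x) + 1.
have k0 : 0 < k by have := nrm_ge0 x; have := nrm_ge0 (A x); rewrite /k; lra.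
have [|N hN] := h_small (e := k^-1); first by rewrite invr_gt0.
have := key N; apply/negP; rewrite -ltNge.
apply: (@le_lt_trans _ _ (h ^+ N * k)); first by rewrite ler_pM2l // /k; lra.
by rewrite -ltr_pdivlMr // div1r.
Qed.

End Hump.

(** * Classification of the closed ideals *)

Section Classification.
Context {R : realType} {H : completeNormedModType R[i]}.
Variable dot : {dot H for Num.conj}.
Hypothesis Hdot : norm_from_dot dot.
Implicit Types (V B C D E : set H) (x y : H) (A : H -> H).

Lemma JidealE (a : set H) : infinite_set a -> Jideal dot a = card_compact a.
Proof.
by move=> ainf; apply/seteqP; split; [exact: Jideal_sub_card_compact|exact: card_compact_sub_Jideal].
Qed.

Lemma eq_card_Jideal T T' (a : set T) (a' : set T') :
  a #= a' -> Jideal dot a = Jideal dot a'.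
Proof.
move=> aa'; apply/funext => A.
by rewrite /Jideal /= /card_lt (card_le_eqr aa') !(card_eqr aa').
Qed.

Lemma oproj_unique C (Q : H -> H) : orthonormal_set dot C -> bounded_op Q ->
  (forall c, C c -> Q c = c) -> (forall x, perp dot C x -> Q x = 0) -> Q = oproj dot C.
Proof.
move=> oC bQ QC Qp; apply/funext => x; have lQ := bounded_linear bQ.
rewrite -{1}(subrK (oproj dot C x) x) (linD lQ) Qp ?add0r; last exact: sub_oproj_perp.
by apply: (eq_on_closure_span bQ bounded_id) (oproj_closure Hdot oC x).
Qed.

(** For the projections, membership in the class only depends on the rank. *)
Lemma card_compact_oproj (a : set H) C : infinite_set a -> orthonormal_set dot C ->
  card_compact a (oproj dot C) <-> card_lt C a.
Proof.
move=> ainf oC; split=> [[_ sC]|Ca].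
  have [|D Da DC] := sC 2^-1; first by rewrite invr_gt0.
  apply: (card_lt_of_approx Hdot ainf Da oC) => c Cc.
  have [y Dy] := DC c; rewrite (oproj_basis Hdot oC Cc) (orthonormal_nrm Hdot oC Cc) mulr1.
  by exists y.
split; first exact: bounded_oproj.
move=> e e0; exists C => // x; have [->|x0] := eqVneq x 0.
  exists 0; first exact: (subspace0 (lin_span_subspace _)).
  rewrite (lin0 (bounded_linear (bounded_oproj Hdot oC))) subr0 nrm0 mulr0 //.
have /closure_nrmP/(_ (e * nrm x))[|y Cy xy] := oproj_closure Hdot oC x.
  by rewrite mulr_gt0 // nrm_gt0.
by exists y => //; exact: ltW.
Qed.

Lemma oproj_setU1 C e : orthonormal_set dot (C `|` [set e]) -> ~ C e ->
  oproj dot (C `|` [set e]) = oproj dot C + oproj dot [set e].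
Proof.
move=> oCe nCe.
have oC : orthonormal_set dot C by apply: orthonormal_sub oCe; left.
have oe : orthonormal_set dot [set e] by apply: orthonormal_sub oCe; right.
have ce c : C c -> dot c e = 0.
  move=> Cc; rewrite oCe; [|by left|by right].
  by case: eqP => // cE; case: nCe; rewrite -cE.
apply/esym/oproj_unique => //.
- by apply: bounded_add; exact: bounded_oproj.
- move=> c [Cc|->]; rewrite [LHS]/GRing.add /=.
    rewrite (oproj_basis Hdot oC Cc) (oproj_perp Hdot oe) ?addr0 // => _ ->.
    exact: ce.
  rewrite (oproj_perp Hdot oC) ?(oproj_basis Hdot oe) ?add0r // => d /ce.
  exact: dot_eq0_sym.
- move=> x px; rewrite [LHS]/GRing.add /= !oproj_perp ?addr0 //.
    by move=> c cE; apply: px; right.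
  by move=> c Cc; apply: px; left.
Qed.

Section Ideal.
Variable I : set (H -> H).
Hypothesis idI : two_sided_ideal I.

(** The projection onto [C] factors through [A]: embed [C] into [X], apply [A]
    and its inverse on the image of [X], and go back to [C]. *)
Lemma ideal_oproj A e X C : I A -> 0 < e -> bounded_below_set dot A e X ->
  orthonormal_set dot C -> C #<= X -> I (oproj dot C).
Proof.
move=> IA e0 gX oC /card_leE[f [fX finj]]; have [sub _ _ _ comp] := idI.
have bA := sub _ IA; have [oX _ _] := gX.
have [T [Y [bT TA _ _ _]]] := bounded_below_inverse Hdot bA e0 gX.
have [S [S' [bS bS' SC SC' [Sp _]]]] := isometry_of_inj Hdot oC oX fX finj.
have <- : S' \o (T \o (A \o S)) = oproj dot C.
  apply: oproj_unique => //.
  - by do 3!apply: bounded_comp => //.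
  - by move=> c Cc /=; rewrite SC // TA ?SC' //; exact: fX.
  - move=> x px /=; rewrite Sp // !lin0 //; exact: bounded_linear.
by apply: (comp _ _ bS' _).1; apply: (comp _ _ bT _).1; exact: (comp _ _ bS IA).2.
Qed.

(** A nonzero operator is bounded below on a single vector, which gives the
    projections of rank one; the others are sums of these. *)
Lemma ideal_finite_oproj C : I <> [set 0] -> orthonormal_set dot C -> finite_set C ->
  I (oproj dot C).
Proof.
move=> I0 oC; have [sub Izero Iadd _ _] := idI.
have [A [IA A0]] : exists A, I A /\ A <> 0.
  apply: contrapT => /forallNP nA; apply: I0; apply/seteqP; split=> [A IA|_ -> //].
  by apply: contrapT => A0; apply: (nA A).
have [x Ax] : exists x, A x != 0.
  apply: contrapT => /forallNP nA; apply: A0; apply/funext => x.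
  by apply/eqP/negPn/negP; exact: nA.
have lA := bounded_linear (sub _ IA).
have x0 : x != 0 by apply: contra_neq Ax => ->; exact: lin0.
pose u := normalize x.
have u1 := nrm_normalize x0.
have Au : 0 < nrm (A u).
  rewrite nrm_gt0; apply: contra_neq Ax => Au.
  by rewrite -(normalizeK x) (linZ lA) Au scaler0.
have gu : bounded_below_set dot A (nrm (A u)) [set u].
  split=> [_ _ -> ->|_ _ -> ->|_ ->] //; last by rewrite eqxx.
  by rewrite eqxx; apply/(unit_nrm Hdot).
have I1 c : orthonormal_set dot [set c] -> I (oproj dot [set c]).
  move=> oc; apply: (ideal_oproj IA Au gu oc).
  by apply: (@set_inj_card_le _ _ _ _ (fun=> u)) => // y z -> ->.
move=> /finite_seqP[s Cs]; elim: s C Cs oC => [|d s IH] C ->.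
  move=> o0; rewrite -(@oproj_unique _ 0) //; first exact: bounded0.
have E : [set` d :: s] = [set` s] `|` [set d].
  apply/seteqP; split=> y /=; rewrite inE => h.
    by case/predU1P: h => [->|]; [right|left].
  by case: h => [->|->]; rewrite ?eqxx ?orbT.
have [ds|ds] := pselect ([set` s] d).
  rewrite (_ : [set` d :: s] = [set` s]); first by move=> os; exact: IH.
  by rewrite E; apply/seteqP; split=> y; [case=> // ->|left].
rewrite E => os; rewrite oproj_setU1 //; apply: Iadd.
  by apply: IH => //; apply: orthonormal_sub os; left.
by apply: I1; apply: orthonormal_sub os; right.
Qed.

End Ideal.

(** The cardinal is a smallest subset of a basis of [H] whose projection is
    outside the ideal.  By [ideal_oproj], the ideal then contains every
    projection of smaller rank. *)
Lemma closed_ideal_Jideal (I : set (H -> H)) : closed_ideal I ->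
  I <> [set 0] -> I <> bounded_op ->
  exists a : set H, admissible_card dot a /\ I = Jideal dot a.
Proof.
move=> [idI clI] I0 IB; have [sub _ _ _ comp] := idI.
have sT : subspace_of_hilbert [set: H] by [].
have [oB BT] := hdimP Hdot sT (@closureT H); set B := hdim dot _ in oB BT.
pose F := [set C | C `<=` B /\ ~ I (oproj dot C)].
have FB : F B.
  split=> // IPB; apply: IB; apply/seteqP; split=> // A bA.
  have <- : A \o oproj dot B = A.
    by apply/funext => x /=; rewrite oproj_id // BT.
  exact: (comp _ _ bA IPB).1.
have [a [[aB nIa] amin]] := card_min id (ex_intro F B FB).
have oa : orthonormal_set dot a by exact: orthonormal_sub oB.
have ainf : infinite_set a by move=> afin; apply: nIa; exact: ideal_finite_oproj.
exists a; split; first by split=> //; exact: subset_card_le.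
rewrite JidealE //; apply/seteqP; split=> A.
  move=> IA; apply: contrapT => nsA.
  have [e [X [e0 gX aX]]] := bounded_below_set_exists Hdot ainf (sub _ IA) nsA.
  by apply: nIa; exact: ideal_oproj gX oa aX.
move=> [bA sA]; apply: clI => // e e0.
have e20 : 0 < e / 2 by rewrite divr_gt0.
have [D Da DA] := sA _ e20.
have [E [oE ED]] := basis_exists Hdot (closure_lin_span_subspace D) (closure_closure _).
have Ea : card_lt E a.
  apply: (card_lt_of_approx Hdot ainf Da oE) => b Eb.
  have : closure (lin_span D) b by rewrite -ED; exact: sub_closure_lin_span.
  move=> /closure_nrmP/(_ 2^-1)[|y Dy yb]; first by rewrite invr_gt0.
  by exists y => //; exact: ltW.
have IE : I (oproj dot E).
  have /card_leE[f [fEa finj]] := card_ltW Ea.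
  have fEB : f @` E `<=` B by move=> _ [x /fEa/aB Bx <-].
  have Ef : E #= f @` E.
    by apply/card_esym/inj_card_eq => x y /set_mem Ex /set_mem Ey; exact: finj.
  have ofE : orthonormal_set dot (f @` E) by exact: orthonormal_sub oB.
  have IfE : I (oproj dot (f @` E)).
    apply: contrapT => nI; have /amin : F (f @` E) by [].
    by rewrite -(card_le_eqr Ef); case/card_ltP : Ea.
  have gE : bounded_below_set dot (oproj dot (f @` E)) 1 (f @` E).
    split=> // [x y Ex Ey xy|x Ex].
      by rewrite !oproj_basis // ofE // (negPf xy).
    by rewrite oproj_basis // (orthonormal_nrm Hdot ofE Ex).
  apply: (ideal_oproj idI IfE ltr01 gE oE).
  by case/card_eqPle: Ef.
exists (oproj dot E \o A); first exact: (comp _ _ bA IE).2.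
apply: (@le_lt_trans _ _ (e / 2)); last by rewrite ltr_pdivrMr // ltr_pMr // ltr1n.
apply: opnorm_le; first exact: ltW.
move=> x; have [y Dy xy] := DA x; apply: le_trans xy.
apply: (oproj_best Hdot oE); rewrite ED; exact: subset_closure.
Qed.

Lemma admissible_subset T (alpha : set T) : admissible_card dot alpha ->
  exists a : set H, [/\ infinite_set a, orthonormal_set dot a & alpha #= a].
Proof.
have sT : subspace_of_hilbert [set: H] by [].
have [oB _] := hdimP Hdot sT (@closureT H).
move=> [ainf /card_leE[f [fB finj]]].
have af : alpha #= f @` alpha.
  by apply/card_esym/inj_card_eq => x y /set_mem Ex /set_mem Ey; exact: finj.
exists (f @` alpha); split=> //; first by rewrite -(eq_finite_set af).
by apply: orthonormal_sub oB => _ [x /fB Bx <-].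
Qed.

Lemma Jideal_card_lt (a a' : set H) : infinite_set a -> infinite_set a' ->
  orthonormal_set dot a -> card_lt a a' -> Jideal dot a <> Jideal dot a'.
Proof.
move=> ainf ainf' oa aa' E.
have : card_compact a (oproj dot a) by rewrite -JidealE // E JidealE //; apply/card_compact_oproj.
by move=> /(card_compact_oproj ainf oa)/card_ltP[_]; apply.
Qed.

End Classification.

Theorem theorem4p2 (R : realType) (H : completeNormedModType R[i])
    (dot : {dot H for Num.conj}) (Hdot : norm_from_dot dot)
    (Hnonsep : ~ separable H) :
  [/\ forall (T : Type) (alpha : set T), admissible_card dot alpha ->
        closed_ideal (Jideal dot alpha),
      forall (T T' : Type) (alpha : set T) (alpha' : set T'),
        admissible_card dot alpha -> admissible_card dot alpha' ->
        alpha #!= alpha' -> Jideal dot alpha <> Jideal dot alpha'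
    & forall I : set (H -> H), closed_ideal I ->
        I <> [set 0] -> I <> bounded_op ->
        exists (T : Type) (alpha : set T),
          admissible_card dot alpha /\ I = Jideal dot alpha].
Proof.
split.
- move=> T alpha /(admissible_subset Hdot)[a [ainf _ aa]].
  by rewrite (eq_card_Jideal dot aa) (JidealE Hdot ainf); exact: card_compact_closed_ideal.
- move=> T T' alpha alpha' /(admissible_subset Hdot)[a [ainf oa aa]].
  move=> /(admissible_subset Hdot)[a' [ainf' oa' aa']].
  rewrite (card_eql aa) (card_eqr aa') => naa'.
  rewrite (eq_card_Jideal dot aa) (eq_card_Jideal dot aa').
  have [le|le] := card_le_total a a'.
    by apply: Jideal_card_lt => //; rewrite /card_lt le.
  apply/nesym; apply: Jideal_card_lt => //; rewrite /card_lt le /=.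
  by rewrite card_eq_sym.
- move=> I cI I0 IB; have [a aP] := closed_ideal_Jideal Hdot cI I0 IB.
  by exists H, a.
Qed.
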